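(* Let $g \in L_\infty(\mathbb{T})$, and let $\Gamma_g \colon \mathcal{H}_2 \to \mathcal{H}_2$ be the Hankel operator with symbol $g$. Then $$\inf_{f \in \mathcal{H}_\infty^\perp} \| g - f \|_\infty = \| \Gamma_g \|,$$ where $\|\Gamma_g\|$ is the operator norm of $\Gamma_g$ on $\mathcal{H}_2$. Moreover, the infimum is attained at some $f_{\text{opt}} \in \mathcal{H}_\infty^\perp$. Furthermore, let $f_{\text{opt}} \in \mathcal{H}_\infty^\perp$ attain the infimum; if there is a non-zero $y \in \mathcal{H}_2$ such that $\| \Gamma_g y \|_2 = \| \Gamma_g \| \, \| y \|_2$, then $|g(e^{i\omega}) - f_{\text{opt}}(e^{i\omega})|$ is constant with respect to $\omega$ for almost all $\omega \in [-\pi, \pi)$.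
   Context: Let $\mathbb{T} = \{ z \in \mathbb{C} : |z| = 1 \}$. For $1 \leq p \leq \infty$, $L_p(\mathbb{T})$ is the usual complex Lebesgue space of (classes of) measurable functions $f \colon \mathbb{T} \to \mathbb{C}$, with norm $\|f\|_p = \left( \frac{1}{2\pi} \int_{-\pi}^{\pi} |f(e^{i\omega})|^p \, d\omega \right)^{1/p}$ for $p < \infty$ and $\|f\|_\infty = \operatorname{ess\,sup}_{\omega \in [-\pi,\pi)} |f(e^{i\omega})|$. $L_2(\mathbb{T})$ is a Hilbert space with inner product $(f,h) = \frac{1}{2\pi} \int_{-\pi}^{\pi} f(e^{i\omega}) \overline{h(e^{i\omega})} \, d\omega$. Hardy spaces follow the control convention: they consist of functions analytic on the exterior $\{|z|>1\}$ of the unit disk, identified with their radial limits on $\mathbb{T}$. Thus $\mathcal{H}_p$ is identified with the closed subspace of those $f \in L_p(\mathbb{T})$ such that $\int_{-\pi}^{\pi} f(e^{i\omega}) e^{-in\omega} \, d\omega = 0$ for every integer $n \geq 1$, i.e., with (formal) Fourier series $f(z) = a_0 + a_1 z^{-1} + a_2 z^{-2} + \cdots$. $\mathcal{H}_\infty^\perp$ denotes (by abuse of notation) the linear subspace of $L_\infty(\mathbb{T})$ consisting of the functions with Fourier series of the form $f(z) = a_1 z + a_2 z^2 + \cdots$, i.e., those $f \in L_\infty(\mathbb{T})$ with $\int_{-\pi}^{\pi} f(e^{i\omega}) e^{-in\omega} \, d\omega = 0$ for every integer $n \leq 0$. For $g \in L_\infty(\mathbb{T})$, the Hankel operator with symbol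 $g$ is the linear operator on $\mathcal{H}_2$ given by $\Gamma_g := P_{\mathcal{H}_2} M_g R$, where $P_{\mathcal{H}_2}$ is the orthogonal projection of $L_2(\mathbb{T})$ onto $\mathcal{H}_2$, $M_g f := g f$ is the multiplication operator on $L_2(\mathbb{T})$, and $R$ is the reversion operator on $L_2(\mathbb{T})$, $(Rf)(e^{i\omega}) := f(e^{-i\omega})$. *)

(* Defs.v *)
From mathcomp Require Import all_boot all_order all_algebra.
From mathcomp Require Import all_classical all_reals all_analysis.
From mathcomp Require Import complex.

Set Implicit Arguments.
Unset Strict Implicit.
Unset Printing Implicit Defensive.

Import Order.TTheory GRing.Theory Num.Theory.
Import numFieldNormedType.Exports.

Local Open Scope classical_set_scope.
Local Open Scope ring_scope.
Local Open Scope complex_scope.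

Definition circle (R : realType) : Type := {z : R[i] | `|z| == 1}.

Lemma norm_cis (R : realType) (w : R) : `|cos w +i* sin w| == 1.
Proof. by rewrite normc_def /= cos2Dsin2 sqrtr1. Qed.

Definition cis (R : realType) (w : R) : circle R :=
  exist (fun z : R[i] => `|z| == 1) _ (norm_cis w).

Lemma norm_circle_conj (R : realType) (z : circle R) : `|(sval z)^*| == 1.
Proof. by case: z => [[a b]] /=; rewrite !normc_def /= sqrrN. Qed.

Definition circle_conj (R : realType) (z : circle R) : circle R :=
  exist (fun u : R[i] => `|u| == 1) _ (norm_circle_conj z).

Lemma invr_2pi_ge0 (R : realType) : 0 <= (2 * pi)^-1 :> R.
Proof. by rewrite invr_ge0 mulr_ge0 ?pi_ge0. Qed.

(* Normalised arc length, carried by the angle: $d\omega / 2\pi$ on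
   $[-\pi, \pi)$, extended by $0$ to the whole line. *)
Definition arc_measure (R : realType) : {measure set (measurableTypeR R) -> \bar R} :=
  mscale (NngNum (invr_2pi_ge0 R))
    (mrestr lebesgue_measure (measurable_itv `[(- pi)%R, pi[%R)).

(* $|z|$ as a real number: in [R[i]] the norm is itself complex-valued. *)
Definition modulus (R : realType) (z : R[i]) : R := complex.Re `|z|.

Definition circle_integral (R : realType) (f : circle R -> R[i]) : R[i] :=
  Rintegral (arc_measure R) setT (fun w => complex.Re (f (cis w)))
  +i* Rintegral (arc_measure R) setT (fun w => complex.Im (f (cis w))).

Definition circle_measurable (R : realType) (f : circle R -> R[i]) : Prop :=
  measurable_fun [set: R] (fun w : R => complex.Re (f (cis w))) /\
  measurable_fun [set: R] (fun w : R => complex.Im (f (cis w))).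

Definition Lp_norm (R : realType) (p : \bar R) (f : circle R -> R[i]) : \bar R :=
  ('N[arc_measure R]_p[(fun w => (modulus (f (cis w)))%:E)])%E.

(* Elements of the Lebesgue and Hardy spaces are represented by functions;
   two functions that agree almost everywhere denote the same element. *)
Definition Lp (R : realType) (p : \bar R) : set (circle R -> R[i]) :=
  [set f | circle_measurable f /\ (Lp_norm p f < +oo)%E].

Definition ae_zero (R : realType) (f : circle R -> R[i]) : Prop :=
  {ae arc_measure R, forall w : R, f (cis w) = 0}.

Definition inner (R : realType) (f h : circle R -> R[i]) : R[i] :=
  circle_integral (fun z => f z * (h z)^*).

Definition fourier (R : realType) (f : circle R -> R[i]) (n : int) : R[i] :=
  circle_integral (fun z => f z * (sval z) ^ (- n)).

(* Functions analytic outside the closed disk: only the powers $z^{-n}$ with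
   $n \geq 0$ occur. *)
Definition Hardy (R : realType) (p : \bar R) : set (circle R -> R[i]) :=
  [set f | Lp p f /\ forall n : int, 1 <= n -> fourier f n = 0].

Definition Hardy_perp_infty (R : realType) : set (circle R -> R[i]) :=
  [set f | Lp +oo%E f /\ forall n : int, n <= 0 -> fourier f n = 0].

(* The set of admissible values depends only on the class of [f], and is
   nonempty when [S] is a closed subspace of $L_2$ and [f] is in $L_2$; all its
   elements are then equal almost everywhere. *)
Definition orth_proj (R : realType) (S : set (circle R -> R[i]))
    (f : circle R -> R[i]) : circle R -> R[i] :=
  xget (fun=> 0)
    [set h | S h /\ forall k, S k -> inner (fun z => f z - h z) k = 0].

Definition mul_op (R : realType) (g f : circle R -> R[i]) : circle R -> R[i] :=
  fun z => g z * f z.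

Definition reversion (R : realType) (f : circle R -> R[i]) : circle R -> R[i] :=
  fun z => f (circle_conj z).

Definition hankel (R : realType) (g y : circle R -> R[i]) : circle R -> R[i] :=
  orth_proj (Hardy 2%:E) (mul_op g (reversion y)).

Definition H2_opnorm (R : realType)
    (A : (circle R -> R[i]) -> (circle R -> R[i])) : \bar R :=
  ereal_sup [set Lp_norm 2%:E (A y) |
             y in [set y | Hardy 2%:E y /\ (Lp_norm 2%:E y <= 1)%E]].

Definition dist_Hardy_perp (R : realType) (g : circle R -> R[i]) : \bar R :=
  ereal_inf [set Lp_norm +oo%E (fun z => g z - f z) |
             f in @Hardy_perp_infty R].

(* Main.v *)
(** Write [N] for the norm of the Hankel operator [Gamma]. For [y, x] in [H_2] one has
    [(Gamma y, x) = (g, y# x)] with [y#(z) = conj (y (conj z))]. A Szego-type projection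
    factors any [k] in [H_2] as a product of two [H_2] functions whose norms multiply to
    about [||k||_1], hence [|(g, k)| <= N ||k||_1]. Among the [a] with [||g - a||_oo <= N],
    choose one whose projection [k] on [H_2] has minimal norm: comparing it with
    [g - N k / |k|] gives [||k||^2 <= Re (g, k) - N ||k||_1 <= 0], so [a] lies in [H_oo^perp]
    and realizes the distance. If [Gamma] attains its norm at [y] then the integral of
    [(N^2 - |g - f|^2) |R y|^2] vanishes, and a nonzero [y] in [H_2] vanishes only on a
    null set, which follows from the same projection. *)

(* Existence of a best approximant is usually a weak-star compactness or Hahn-Banach argument. Here
   it is a quadratic minimization, for which completeness of L_2 suffices. The obstacle is that
   minimizing the norm of the projection [k] makes the [k] converge but says nothing about the
   symbols [a]. The squared norm of [a], which stays bounded because [a] is essentially bounded, is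
   therefore added with a relative weight tending to 0: uniform convexity in [a] then makes the
   symbols converge too, and the pointwise bound on [g - a] survives L_2 limits.

   In the factorization, [|k|] is replaced by [|k| + e], so that division by its square root is a
   bounded operation and no integrability of [log |k|] is involved; the error in the norms
   disappears as [e] tends to 0. Analyticity is always checked on polynomials in [z^-1] and carried
   to L_2 closures by continuity of the inner product. *)
Require Import Defs.
From mathcomp Require Import all_boot all_order all_algebra.
From mathcomp Require Import all_classical all_reals all_analysis.
From mathcomp Require Import measurable_realfun ess_sup_inf.
From mathcomp Require Import complex ring lra zify.

Set Implicit Arguments.
Unset Strict Implicit.
Unset Printing Implicit Defensive.

Import Order.TTheory GRing.Theory Num.Theory.
Import numFieldNormedType.Exports.
Local Open Scope classical_set_scope.
Local Open Scope ring_scope.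

(** * Minimizing sequences and completeness *)

(* [x n] nearly minimizes [(n + 1) (q1 - inf q1) + q2]: the minimal values increase and are
   bounded by [B], so the parallelogram defects [D] tend to 0. *)
Lemma convex_min_seq (R : realType) (T : Type) (K : set T) (q1 q2 : T -> R)
    (mid : T -> T -> T) (B : R) (D := fun (q : T -> R) x y =>
      2 * q x + 2 * q y - 4 * q (mid x y)) :
  K !=set0 -> (forall x y, K x -> K y -> K (mid x y)) ->
  (forall x, K x -> 0 <= q1 x) -> (forall x, K x -> 0 <= q2 x <= B) ->
  (forall x y, K x -> K y -> 0 <= D q1 x y) ->
  (forall x y, K x -> K y -> 0 <= D q2 x y) ->
  exists (d : R) (x : nat -> T), [/\ forall y, K y -> d <= q1 y,
    forall n, K (x n) &
    forall e, 0 < e -> exists N, forall n m, (N <= n)%N -> (N <= m)%N ->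
      [/\ q1 (x n) < d + e, D q1 (x n) (x m) < e & D q2 (x n) (x m) < e]].
Proof.
move=> [k0 Kk0] Kmid q1_ge0 q2B D1 D2.
pose d := inf (q1 @` K).
have hd : has_inf (q1 @` K).
  by split; [exists (q1 k0), k0 | exists 0 => _ [x Kx <-]; exact: q1_ge0].
have dle y : K y -> d <= q1 y by move=> Ky; apply: ge_inf; [case: hd|exists y].
pose J n x := n.+1%:R * (q1 x - d) + q2 x.
have J_ge0 n x : K x -> 0 <= J n x.
  move=> Kx; have /andP[q20 _] := q2B _ Kx.
  by rewrite addr_ge0// mulr_ge0// subr_ge0 dle.
have leJ n m x : K x -> (n <= m)%N -> J n x <= J m x.
  by move=> Kx nm; rewrite lerD2r ler_wpM2r ?subr_ge0 ?dle// ler_nat.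
pose M n := inf (J n @` K).
have hM n : has_inf (J n @` K).
  by split; [exists (J n k0), k0 | exists 0 => _ [x Kx <-]; exact: J_ge0].
have Mle n y : K y -> M n <= J n y.
  by move=> Ky; apply: ge_inf; [case: (hM n)|exists y].
have M_ge n c : (forall y, K y -> c <= J n y) -> c <= M n.
  move=> h; apply: lb_le_inf; first by case: (hM n).
  by move=> _ [x Kx <-]; exact: h.
have MB n : M n <= B.
  apply/ler_addgt0Pr => e e0.
  have [_ [y Ky <-] yd] := inf_adherent (divr_gt0 e0 (ltr0Sn R n)) hd.
  apply: (le_trans (Mle n y Ky)).
  have /andP[_ q2y] := q2B _ Ky.
  rewrite addrC lerD// mulrC -ler_pdivlMr//.
  by rewrite lerBlDl ltW.
have /choice[x xP] n : exists x, K x /\ J n x < M n + n.+1%:R^-1.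
  have n0 : 0 < n.+1%:R^-1 :> R by [].
  by have [_ [y Ky <-] yd] := inf_adherent n0 (hM n); exists y.
have Kx n : K (x n) by case: (xP n).
have leM n m : (n <= m)%N -> M n <= M m.
  by move=> nm; apply: M_ge => y Ky; exact: le_trans (Mle _ _ Ky) (leJ _ _ _ Ky nm).
pose S := sup (range M).
have hS : has_sup (range M).
  by split; [exists (M 0%N), 0%N | exists B => _ [n _ <-]; exact: MB].
have MS n : M n <= S by apply: ub_le_sup; [case: hS|exists n].
exists d, x; split => // e e0.
(* With error [e / 8] on each value of [J N], its defect is below [2 (S + e/8) + 2 (S + e/8) - 4 (S
   - e/8) = e]. *)
have e8 : 0 < e / 8%:R by rewrite divr_gt0.
have [_ [N1 _ <-] N1S] := sup_adherent e8 hS.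
have B1 : 0 < B + 1.
  by rewrite ltr_wpDl//; have /andP[h1 h2] := q2B _ Kk0; exact: le_trans h1 h2.
have [N2 _ N2e] := near_infty_natSinv_lt (PosNum e8).
have eB : 0 < e / (B + 1) by rewrite divr_gt0.
have [N3 _ N3e] := near_infty_natSinv_lt (PosNum eB).
pose N := maxn N1 (maxn N2 N3); exists N => n m Nn Nm.
have N1N : (N1 <= N)%N by rewrite leq_maxl.
have N2N : (N2 <= N)%N by rewrite /N leq_max leq_maxl orbT.
have N3N : (N3 <= N)%N by rewrite /N !leq_max leqnn !orbT.
have inv k : (N <= k)%N -> k.+1%:R^-1 < e / 8%:R.
  by move=> Nk; apply: N2e => /=; exact: leq_trans Nk.
have JN k : (N <= k)%N -> J N (x k) < S + e / 8%:R.
  move=> Nk; apply: le_lt_trans (leJ _ _ _ (Kx k) Nk) _.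
  have [_ h] := xP k; apply: (lt_le_trans h).
  by rewrite lerD ?MS// ltW// inv.
have Jmid : S - e / 8%:R < J N (mid (x n) (x m)).
  apply: (lt_le_trans N1S); apply: le_trans (leM _ _ N1N) _.
  exact/Mle/Kmid.
have DJ : N.+1%:R * D q1 (x n) (x m) + D q2 (x n) (x m) =
    2 * J N (x n) + 2 * J N (x m) - 4 * J N (mid (x n) (x m)).
  by rewrite /D /J; ring.
have lt_e : N.+1%:R * D q1 (x n) (x m) + D q2 (x n) (x m) < e.
  by rewrite DJ; have := JN n Nn; have := JN m Nm; lra.
have d1 := D1 _ _ (Kx n) (Kx m); have d2 := D2 _ _ (Kx n) (Kx m).
split.
- rewrite -ltrBlDl.
  have [_ h] := xP n.
  have /andP[q20 _] := q2B _ (Kx n).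
  have := MB n => MBn.
  (* The near-minimal value of [J n] is below [M n + 1 <= B + 1], so the excess of [q1] over [d] is
     at most [(B + 1) / (n + 1)]; [N3] was chosen to make this smaller than [e]. *)
  have : n.+1%:R * (q1 (x n) - d) < B + 1.
    have i1 : n.+1%:R^-1 <= 1 :> R by rewrite invf_le1 ?ler1n.
    apply: (@le_lt_trans _ _ (J n (x n))); first by rewrite lerDl.
    by apply: (lt_le_trans h); rewrite lerD.
  rewrite mulrC -ltr_pdivlMr// => /lt_le_trans; apply.
  rewrite mulrC -ler_pdivlMr//.
  by rewrite ltW//; apply: N3e => /=; apply: leq_trans Nn.
- apply: le_lt_trans lt_e; rewrite -[leLHS]addr0 lerD//.
  by rewrite ler_peMl// ler1n.
- by apply: le_lt_trans lt_e; rewrite -[leLHS]add0r lerD// mulr_ge0.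
Qed.

Lemma emeasurable_sqrB d (T : measurableType d) (R : realType) (f g : T -> R) :
  measurable_fun setT f -> measurable_fun setT g ->
  measurable_fun setT (fun x => ((f x - g x) ^+ 2)%:E).
Proof.
move=> mf mg; apply/measurable_EFinP; apply: measurable_funX.
exact: measurable_funB.
Qed.

(** The limit at [x] is a functional [L] of the sequence of values at [x] alone. This lets the limit
    of functions on the circle be defined on the circle again, although the integration variable is
    the angle. *)
Lemma real_L2_complete d (T : measurableType d) (R : realType)
    (mu : {measure set T -> \bar R}) (u : nat -> T -> R) :
  (mu setT < +oo)%E -> (forall n, measurable_fun setT (u n)) ->
  (forall e : R, 0 < e -> exists N, forall n m, (N <= n)%N -> (N <= m)%N ->
    (\int[mu]_x ((u n x - u m x) ^+ 2)%:E <= e%:E)%E) ->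
  exists L : (nat -> R) -> R, measurable_fun setT (fun x => L (u ^~ x)) /\
    forall e : R, 0 < e -> exists N, forall n, (N <= n)%N ->
      (\int[mu]_x ((u n x - L (u ^~ x)) ^+ 2)%:E <= e%:E)%E.
Proof.
move=> muT mu_ uC.
(* The rate [8^-k] leaves [2^k * 8^-k = 4^-k], still summable, after the weight [2^k] used in
   [int_c]. *)
have e8 k : 0 < (8%:R^-1 : R) ^+ k by rewrite exprn_gt0.
have /choice[N NP] k := uC _ (e8 k).
(* Partial sums turn the thresholds [N k] into a nondecreasing sequence of indices that dominates
   them. *)
pose nn k := (\sum_(i < k.+1) N i)%N.
have nnN k : (N k <= nn k)%N by rewrite /nn big_ord_recr leq_addl.
have nnS k : (nn k <= nn k.+1)%N by rewrite /nn [in leqRHS]big_ord_recr leq_addr.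
have nn_nd k m : (k <= m)%N -> (nn k <= nn m)%N.
  by apply: (@homo_leq _ nn leq leqnn leq_trans).
pose v k := u (nn k).
have mv k : measurable_fun setT (v k) by exact: mu_.
have mB := @emeasurable_sqrB _ T R.
pose c k x : R := `|v k.+1 x - v k x|.
have mc k : measurable_fun setT (fun x => (c k x)%:E).
  by apply/measurable_EFinP/measurableT_comp => //; exact: measurable_funB.
have c_ge0 k x : (0 <= (c k x)%:E)%E by rewrite lee_fin /c.
pose M := fine (mu setT) + 1.
have M0 : 0 <= M by rewrite addr_ge0// fine_ge0.
have muM : (mu setT = (M - 1)%:E)%E.
  by rewrite addrK fineK// ge0_fin_numE.
(* The pointwise bound is [t <= 2^-k + 2^k t^2]. The extra 1 in [M] absorbs [4^-k <= 2^-k]. *)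
have int_c k : (\int[mu]_x (c k x)%:E <= ((2^-1) ^+ k * M)%:E)%E.
  have : (\int[mu]_x (c k x)%:E <= \int[mu]_x (((2^-1) ^+ k)%:E +
      (2 ^+ k)%:E * ((v k.+1 x - v k x) ^+ 2)%:E))%E.
    apply: ge0_le_integral => //.
    - by apply: emeasurable_funD => //; apply: measurable_funeM; exact: mB.
    - move=> x _; rewrite -EFinM -EFinD lee_fin /c -[X in _ <= _ + _ * X]real_normK ?num_real//.
      set t := `|v k.+1 x - v k x|; have t0 : 0 <= t := normr_ge0 _.
      rewrite exprVn -[leLHS]mul1r.
      have p0 : 0 < 2 ^+ k :> R by rewrite exprn_gt0.
      rewrite -(ler_pM2l p0) mulrDr divff ?gt_eqF// mul1r mulrA -expr2 -exprMn.
      set s := 2 ^+ k * t; suff : 0 <= (s - 2^-1) ^+ 2 by lra.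
      exact: sqr_ge0.
  move=> /le_trans; apply.
  rewrite ge0_integralD//; last 2 first.
  - by move=> x _; rewrite -EFinM lee_fin mulr_ge0 ?sqr_ge0 ?exprn_ge0.
  - by apply: measurable_funeM; exact: mB.
  rewrite integral_cst//= muM ge0_integralZl_EFin ?exprn_ge0//; last 2 first.
  - by move=> x _; rewrite lee_fin sqr_ge0.
  - exact: mB.
  have h : (\int[mu]_x ((v k.+1 x - v k x) ^+ 2)%:E <= (8^-1 ^+ k)%:E)%E.
    by apply: NP => //; exact: leq_trans (nnN k) (nnS k).
  apply: (@le_trans _ _ (((2^-1) ^+ k)%:E * (M - 1)%:E + (2 ^+ k)%:E * (8^-1 ^+ k)%:E)%E).
    by rewrite leeD2l// lee_pmul2l// lte_fin exprn_gt0.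
  rewrite -!EFinM -EFinD lee_fin -exprMn mulrBr mulr1 -addrA gerDl addrC subr_le0.
  by apply: lerXn2r; rewrite ?nnegrE; lra.
pose G x := (\sum_(0 <= k <oo) (c k x)%:E)%E.
have mG : measurable_fun setT G.
  by apply: ge0_emeasurable_sum => // k x _ _.
have Gint : (\int[mu]_x G x < +oo)%E.
  rewrite integral_nneseries//.
  apply: (@le_lt_trans _ _ (2 * M)%:E); last by rewrite ltry.
  apply: lime_le; first by apply: is_cvg_nneseries => k _ _; exact: integral_ge0.
  apply: nearW => n.
  apply: (@le_trans _ _ (\sum_(0 <= k < n) ((2^-1) ^+ k * M)%:E)%E).
    by apply: lee_sum => k _; exact: int_c.
  rewrite sumEFin lee_fin -mulr_suml ler_wpM2r//.
  suff -> : \sum_(0 <= k < n) (2^-1) ^+ k = 2 - 2 * (2^-1) ^+ n :> R.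
    by rewrite gerBl mulr_ge0 ?exprn_ge0.
  elim: n => [|n IH]; first by rewrite big_geq// expr0; ring.
  by rewrite big_nat_recr//= IH exprS; field.
have Gae : {ae mu, forall x, G x \is a fin_num}.
  have : mu.-integrable setT G.
    apply/integrableP; split => //.
    by under eq_integral do rewrite gee0_abs ?nneseries_ge0//.
  move=> /(integrable_ae measurableT).
  by apply: filterS => x /(_ I).
have Gcvg x : G x \is a fin_num -> cvgn (fun k => v k x).
  move=> Gx.
  have : cvgn [normed series (telescope (fun k => v k x))].
    apply: nondecreasing_is_cvgn.
      apply/nondecreasing_seqP => n.
      by rewrite /normed_series_of /series /= big_nat_recr//= lerDl.
    exists (fine (G x)) => _ [n _ <-].
    rewrite -lee_fin fineK// /series /= -sumEFin.
    exact: nneseries_lim_ge.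
  move=> /normed_cvg /cvg_ex[l vl].
  apply/cvg_ex; exists (v 0%N x + l).
  have -> : (fun k => v k x) = (fun k => v 0%N x + series (telescope (fun k => v k x)) k).
    by apply/funext => k; exact: (eq_sum_telescope (fun k => v k x)).
  by apply: cvgD => //; exact: cvg_cst.
(* The upper limit is measurable without any convergence assumption, and it equals the limit
   wherever [G] is finite. *)
pose f x := fine (limn_esup (fun k => (v k x)%:E)).
have mf : measurable_fun setT f.
  apply: measurableT_comp => //.
  by apply: measurable_fun_limn_esup => k; exact/measurable_EFinP.
have fcvg x : G x \is a fin_num -> v k x @[k --> \oo] --> f x.
  move=> /Gcvg /cvg_ex[l vl].
  have vlE : (v k x)%:E @[k --> \oo] --> l%:E by apply: cvg_EFin => //; exact: nearW.
  by rewrite /f; have [_ ->] := cvg_limn_einf_sup vlE.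
(* Almost everywhere [(u n - f)^2] is the limit of [(u n - v k)^2], and Fatou's lemma passes on the
   bound known for all [k >= j]. *)
have bound j n : (nn j <= n)%N -> (\int[mu]_x ((u n x - f x) ^+ 2)%:E <= (8^-1 ^+ j)%:E)%E.
  move=> jn.
  have -> : (\int[mu]_x ((u n x - f x) ^+ 2)%:E =
      \int[mu]_x limn_einf (fun k => ((u n x - v k x) ^+ 2)%:E))%E.
    have mg k : measurable_fun setT (fun x => ((u n x - v k x) ^+ 2)%:E) by exact: mB.
    apply: ae_eq_integral => //; first exact: mB.
      rewrite /limn_einf; apply: measurableT_comp => //.
      by apply: measurable_fun_limn_esup => k; exact: measurableT_comp.
    apply: filterS Gae => x Gx _.
    suff h : ((u n x - v k x) ^+ 2)%:E @[k --> \oo] --> ((u n x - f x) ^+ 2)%:E.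
      by have [-> _] := cvg_limn_einf_sup h.
    apply: cvg_EFin; first exact: nearW.
    rewrite /comp /= expr2.
    by apply: cvgM; apply: cvgB; [exact: cvg_cst|exact: fcvg|exact: cvg_cst|exact: fcvg].
  apply: le_trans.
    apply: (@fatou _ _ _ mu setT measurableT (fun k x => ((u n x - v k x) ^+ 2)%:E)).
      by move=> k; exact: mB.
    by move=> k x _; rewrite lee_fin sqr_ge0.
  rewrite limn_einf_lim; apply: lime_le; first exact: is_cvg_einfs.
  apply: nearW => m.
  apply: (@le_trans _ _ (\int[mu]_x ((u n x - v (maxn m j) x) ^+ 2)%:E)%E).
    by apply: ereal_inf_lbound; exists (maxn m j) => //=; rewrite leq_maxl.
  apply: NP; first exact: leq_trans (nnN j) jn.
  by apply: leq_trans (nnN j) _; apply: nn_nd; rewrite leq_maxr.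
exists (fun s => fine (limn_esup (fun k => (s (nn k))%:E))); split => // e e0.
have : (8^-1 : R) ^+ j @[j --> \oo] --> (0 : R).
  by apply: cvg_expr; rewrite ger0_norm; lra.
move=> /cvgrPdist_lt /(_ e e0) [j _ /(_ j (leqnn j))] /=.
rewrite sub0r normrN ger0_norm ?exprn_ge0// => je.
exists (nn j) => n jn; apply: le_trans (bound _ _ jn) _.
by rewrite lee_fin ltW.
Qed.

(** * Complex functions on the circle *)

Local Open Scope complex_scope.

Section modulus.
Variable R : realType.
Implicit Types z w a : R[i].

Lemma modulusE z : modulus z = Normc.normc z.
Proof. by case: z => a b; rewrite /modulus normc_def. Qed.

Lemma norm_modulus z : `|z| = (modulus z)%:C.
Proof. by rewrite /modulus normc_def. Qed.

Lemma modulus_ge0 z : 0 <= modulus z.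
Proof. by rewrite modulusE; case: z => a b; rewrite sqrtr_ge0. Qed.

Lemma sqr_modulus z : modulus z ^+ 2 = complex.Re z ^+ 2 + complex.Im z ^+ 2.
Proof. by rewrite modulusE; case: z => a b; rewrite sqr_sqrtr// addr_ge0 ?sqr_ge0. Qed.

Lemma modulusM z w : modulus (z * w) = modulus z * modulus w.
Proof. by rewrite !modulusE Normc.normcM. Qed.

Lemma modulusV z : modulus z^-1 = (modulus z)^-1.
Proof. by rewrite !modulusE Normc.normcV. Qed.

Lemma modulus_conj z : modulus z^*%C = modulus z.
Proof. by rewrite /modulus normcJ. Qed.

Lemma modulus_eq0 z : (modulus z == 0) = (z == 0).
Proof.
apply/eqP/eqP => [|->]; rewrite modulusE; first exact: Normc.eq0_normc.
exact: Normc.normc0.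
Qed.

Lemma modulusR (x : R) : modulus x%:C = `|x|.
Proof. by rewrite modulusE /= expr0n addr0 sqrtr_sqr. Qed.

Lemma modulus_circle (z : circle R) : modulus (sval z) = 1.
Proof.
have /eqP h : `|sval z| == 1 := svalP z.
by rewrite /modulus h.
Qed.

Lemma modulusD z w : modulus (z + w) <= modulus z + modulus w.
Proof. by rewrite -lecR rmorphD /= -!norm_modulus ler_normD. Qed.

Lemma modulusN z : modulus (- z) = modulus z.
Proof. by rewrite /modulus normrN. Qed.

Lemma modulusB z w : modulus (z - w) = modulus (w - z).
Proof. by rewrite /modulus distrC. Qed.

Lemma normr_Re z : `|complex.Re z| <= modulus z.
Proof. by rewrite -lecR -norm_modulus normc_ge_Re. Qed.

Lemma normr_Im z : `|complex.Im z| <= modulus z.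
Proof.
rewrite -(@ler_pXn2r _ 2)// ?nnegrE ?modulus_ge0//.
by rewrite sqr_modulus real_normK ?num_real// lerDr sqr_ge0.
Qed.

Lemma mul_conj z : z * z^*%C = (modulus z ^+ 2)%:C.
Proof. by rewrite -sqr_normc norm_modulus rmorphXn. Qed.

Lemma sqr_modulusD_le z w : modulus (z + w) ^+ 2 <= 2 * modulus z ^+ 2 + 2 * modulus w ^+ 2.
Proof.
rewrite !sqr_modulus; case: z w => z1 z2 [w1 w2] /=.
have := sqr_ge0 (z1 - w1); have := sqr_ge0 (z2 - w2); nra.
Qed.

Lemma RecM z w : complex.Re (z * w) = complex.Re z * complex.Re w - complex.Im z * complex.Im w.
Proof. by case: z w => ? ? [? ?]. Qed.
Lemma ImcM z w : complex.Im (z * w) = complex.Re z * complex.Im w + complex.Im z * complex.Re w.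
Proof. by case: z w => ? ? [? ?]. Qed.
Lemma RecD z w : complex.Re (z + w) = complex.Re z + complex.Re w.
Proof. by case: z w => ? ? [? ?]. Qed.
Lemma ImcD z w : complex.Im (z + w) = complex.Im z + complex.Im w.
Proof. by case: z w => ? ? [? ?]. Qed.
Lemma RecN z : complex.Re (- z) = - complex.Re z.
Proof. by case: z. Qed.
Lemma ImcN z : complex.Im (- z) = - complex.Im z.
Proof. by case: z. Qed.
Lemma Rec_conj z : complex.Re z^*%C = complex.Re z.
Proof. by case: z. Qed.
Lemma Imc_conj z : complex.Im z^*%C = - complex.Im z.
Proof. by case: z. Qed.
Definition RecImcE := (RecM, ImcM, RecD, ImcD, RecN, ImcN, Rec_conj, Imc_conj).

Lemma complex_eq z w : complex.Re z = complex.Re w -> complex.Im z = complex.Im w -> z = w.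
Proof. by case: z w => ? ? [? ?] /= -> ->. Qed.

End modulus.

Section circle_measurable.
Variable R : realType.
Implicit Types f g : circle R -> R[i].

Lemma circle_measurable_cst (a : R[i]) : circle_measurable (fun _ : circle R => a).
Proof. by []. Qed.

Lemma circle_measurableD f g : circle_measurable f -> circle_measurable g ->
  circle_measurable (fun z => f z + g z).
Proof.
move=> [f1 f2] [g1 g2]; split; under eq_fun do rewrite !RecImcE;
  exact: measurable_funD.
Qed.

Lemma circle_measurableM f g : circle_measurable f -> circle_measurable g ->
  circle_measurable (fun z => f z * g z).
Proof.
move=> [f1 f2] [g1 g2]; split; under eq_fun do rewrite !RecImcE.
  by apply: measurable_funB; exact: measurable_funM.
by apply: measurable_funD; exact: measurable_funM.
Qed.

Lemma circle_measurableN f : circle_measurable f -> circle_measurable (fun z => - f z).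
Proof.
by move=> [f1 f2]; split; under eq_fun do rewrite !RecImcE; exact: measurable_funN.
Qed.

Lemma circle_measurableB f g : circle_measurable f -> circle_measurable g ->
  circle_measurable (fun z => f z - g z).
Proof. by move=> mf /circle_measurableN; exact: circle_measurableD. Qed.

Lemma circle_measurable_conj f : circle_measurable f -> circle_measurable (fun z => (f z)^*%C).
Proof.
move=> [f1 f2]; split; under eq_fun do rewrite !RecImcE; first exact: f1.
exact: measurable_funN.
Qed.

Lemma circle_measurable_real (r : circle R -> R) :
  measurable_fun [set: R] (fun w => r (cis w)) -> circle_measurable (fun z => (r z)%:C).
Proof. by move=> mr; split. Qed.

Lemma measurable_modulus f : circle_measurable f ->
  measurable_fun [set: R] (fun w => modulus (f (cis w))).
Proof.
move=> [f1 f2].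
have -> : (fun w => modulus (f (cis w))) = (fun w =>
    ((complex.Re (f (cis w)) ^+ 2 + complex.Im (f (cis w)) ^+ 2) `^ (2^-1))).
  apply/funext => w; rewrite -sqr_modulus powR12_sqrt ?sqr_ge0//.
  by rewrite sqrtr_sqr ger0_norm// modulus_ge0.
have m := measurable_funD (measurable_funX 2 f1) (measurable_funX 2 f2).
exact: (measurableT_comp (measurable_powR 2^-1) m).
Qed.

(** Inversion agrees with the real power of exponent -1 on the nonnegative reals, even at 0, where
    both conventions give 0. *)
Lemma measurable_invr_ge0 (r : R -> R) : (forall w, 0 <= r w) ->
  measurable_fun [set: R] r -> measurable_fun [set: R] (fun w => (r w)^-1).
Proof.
move=> r0 mr; under eq_fun do rewrite -powR_inv1//.
exact: measurableT_comp (measurable_powR (-1)) mr.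
Qed.

Lemma circle_measurableV f : circle_measurable f -> circle_measurable (fun z => (f z)^-1).
Proof.
move=> mf.
have -> : (fun z => (f z)^-1) = (fun z => ((modulus (f z) ^+ 2)^-1)%:C * (f z)^*%C).
  by apply/funext => z; rewrite invc_norm norm_modulus fmorphV rmorphXn.
apply: circle_measurableM; last exact: circle_measurable_conj.
apply: circle_measurable_real; apply: measurable_invr_ge0 => [w|].
  exact: sqr_ge0.
by apply: measurable_funX; exact: measurable_modulus.
Qed.

Lemma circle_measurable_sval : circle_measurable (fun z : circle R => sval z).
Proof.
by split => /=; apply: continuous_measurable_fun; [exact: continuous_cos|exact: continuous_sin].
Qed.

Lemma circle_measurableX f n : circle_measurable f -> circle_measurable (fun z => f z ^+ n).
Proof.
move=> mf; elim: n => [|n IH]; first exact: circle_measurable_cst.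
by under eq_fun do rewrite exprS; exact: circle_measurableM.
Qed.

Lemma circle_measurableXz f (n : int) : circle_measurable f ->
  circle_measurable (fun z => f z ^ n).
Proof.
move=> mf; case: n => n; first exact: circle_measurableX.
by apply: circle_measurableV; exact: circle_measurableX.
Qed.

Lemma cisN w : circle_conj (@cis R w) = cis (- w).
Proof. by apply: val_inj => /=; rewrite cosN sinN. Qed.

Lemma circle_measurable_comp_conj f : circle_measurable f ->
  circle_measurable (fun z => f (circle_conj z)).
Proof.
have mN : measurable_fun [set: R] (-%R : R -> R) by exact: measurable_funN.
move=> [f1 f2]; split; under eq_fun do rewrite cisN.
  exact: (measurableT_comp f1 mN).
exact: (measurableT_comp f2 mN).
Qed.

End circle_measurable.

Lemma ae_imp d (T : measurableType d) (R : realType) (mu : {measure set T -> \bar R})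
    (P Q : T -> Prop) : {ae mu, forall x, P x} -> (forall x, P x -> Q x) ->
  {ae mu, forall x, Q x}.
Proof. by move=> Pae PQ; exact: filterS Pae. Qed.

Lemma ae_imp2 d (T : measurableType d) (R : realType) (mu : {measure set T -> \bar R})
    (P P' Q : T -> Prop) : {ae mu, forall x, P x} -> {ae mu, forall x, P' x} ->
  (forall x, P x -> P' x -> Q x) -> {ae mu, forall x, Q x}.
Proof. by move=> Pae Pae' PQ; exact: filterS2 Pae Pae'. Qed.

Section circle_integral.
Variable R : realType.
Implicit Types (f g h : circle R -> R[i]) (a : R[i]).
Local Notation mu := (arc_measure R).

Lemma arc_measureE (A : set R) :
  mu A = (((2 * pi)^-1)%:E * lebesgue_measure (A `&` `[(- pi)%R, pi[))%E.
Proof. by []. Qed.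

Lemma arc_measureT : mu setT = 1%E.
Proof.
rewrite arc_measureE setTI lebesgue_measure_itv /=.
rewrite lte_fin ifT; last by rewrite gtrN// pi_gt0.
rewrite -EFinB -EFinM; congr EFin; have := pi_gt0 R => p0.
by rewrite opprK -mulr2n -(mulr_natl pi) mulVf// gt_eqF// mulr_gt0.
Qed.

Lemma emeasurable_modulus f : circle_measurable f ->
  measurable_fun [set: measurableTypeR R] (fun w => (modulus (f (cis w)))%:E).
Proof. by move=> mf; apply/measurable_EFinP; exact: (measurable_modulus mf). Qed.

Definition cintegrable f := circle_measurable f /\
  mu.-integrable setT (fun w => (modulus (f (cis w)))%:E).

Lemma cintegrable_le f g : circle_measurable f -> cintegrable g ->
  (forall z, modulus (f z) <= modulus (g z)) -> cintegrable f.
Proof.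
move=> mf [mg ig] fg; split => //.
apply: le_integrable ig => //.
- exact: emeasurable_modulus.
- by move=> w _ /=; rewrite lee_fin !ger0_norm ?modulus_ge0.
Qed.

Lemma integrable_Re f : cintegrable f ->
  mu.-integrable setT (EFin \o (fun w => complex.Re (f (cis w)))).
Proof.
move=> [[mf _] fi]; apply: le_integrable fi => //.
- exact/measurable_EFinP.
- by move=> w _ /=; rewrite lee_fin [leRHS]ger0_norm ?modulus_ge0// normr_Re.
Qed.

Lemma integrable_Im f : cintegrable f ->
  mu.-integrable setT (EFin \o (fun w => complex.Im (f (cis w)))).
Proof.
move=> [[_ mf] fi]; apply: le_integrable fi => //.
- exact/measurable_EFinP.
- by move=> w _ /=; rewrite lee_fin [leRHS]ger0_norm ?modulus_ge0// normr_Im.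
Qed.

Lemma cintegrable_real (r : circle R -> R) :
  mu.-integrable setT (EFin \o (fun w => r (cis w))) -> cintegrable (fun z => (r z)%:C).
Proof.
move=> ir; split.
  by apply: circle_measurable_real; apply/measurable_EFinP; case/integrableP: ir.
under eq_fun do rewrite modulusR.
exact: integrable_norm ir.
Qed.

Lemma cintegrableZ a f : cintegrable f -> cintegrable (fun z => a * f z).
Proof.
move=> [mf fi]; split.
  by apply: circle_measurableM => //; exact: circle_measurable_cst.
under eq_fun do rewrite modulusM EFinM.
exact: integrableZl.
Qed.

Lemma cintegrableD f g : cintegrable f -> cintegrable g ->
  cintegrable (fun z => f z + g z).
Proof.
move=> [mf fi] [mg gi]; split; first exact: circle_measurableD.
apply: le_integrable (integrableD measurableT fi gi) => //.
- exact: (emeasurable_modulus (circle_measurableD mf mg)).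
- move=> w _ /=; rewrite lee_fin !ger0_norm ?addr_ge0 ?modulus_ge0//.
  exact: modulusD.
Qed.

Lemma circle_integralD f g : cintegrable f -> cintegrable g ->
  circle_integral (fun z => f z + g z) = circle_integral f + circle_integral g.
Proof.
move=> fi gi; rewrite /circle_integral.
under [X in X +i* _]eq_Rintegral do rewrite RecD.
under [X in _ +i* X]eq_Rintegral do rewrite ImcD.
by rewrite !RintegralD//; do [exact: integrable_Re|exact: integrable_Im].
Qed.

Lemma circle_integralZ a f : cintegrable f ->
  circle_integral (fun z => a * f z) = a * circle_integral f.
Proof.
move=> fi; rewrite /circle_integral.
under [X in X +i* _]eq_Rintegral do rewrite RecM.
under [X in _ +i* X]eq_Rintegral do rewrite ImcM.
have Ri := integrable_Re fi; have Ii := integrable_Im fi.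
rewrite RintegralB//; last 2 first.
- exact: (integrableZl measurableT (complex.Re a) Ri).
- exact: (integrableZl measurableT (complex.Im a) Ii).
rewrite RintegralD//; last 2 first.
- exact: (integrableZl measurableT (complex.Re a) Ii).
- exact: (integrableZl measurableT (complex.Im a) Ri).
by rewrite !RintegralZl//; case: a.
Qed.

Lemma circle_integral_conj f : cintegrable f ->
  circle_integral (fun z => (f z)^*%C) = (circle_integral f)^*%C.
Proof.
move=> fi; rewrite /circle_integral /=.
under [X in X +i* _]eq_Rintegral do rewrite Rec_conj.
under [X in _ +i* X]eq_Rintegral do rewrite Imc_conj -mulN1r.
by rewrite RintegralZl ?mulN1r//; exact: integrable_Im.
Qed.

Lemma circle_integral_real (r : circle R -> R) :
  circle_integral (fun z => (r z)%:C) = (Rintegral mu setT (fun w => r (cis w)))%:C.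
Proof. by rewrite /circle_integral /= Rintegral_cst//= mul0r. Qed.

Lemma circle_integral_ae f g : circle_measurable f -> circle_measurable g ->
  {ae mu, forall w, f (cis w) = g (cis w)} -> circle_integral f = circle_integral g.
Proof.
move=> [f1 f2] [g1 g2] fg; rewrite /circle_integral /Rintegral.
congr (fine _ +i* fine _); apply: ae_eq_integral => //;
  do ?exact/measurable_EFinP;
  by apply: (ae_imp fg) => w /= ->.
Qed.

End circle_integral.

(** The value [t = 1 / s] gives the bound. If [s = 0] the expression is affine in [t], so its slope
    must vanish. In the applications [c] is the squared modulus of an inner product and [s] a
    squared norm. *)
Lemma quadratic_bound (R : realFieldType) (e c s : R) : 0 <= c -> 0 <= s ->
  (forall t, 0 <= e - 2 * t * c + t ^+ 2 * c * s) -> c <= e * s.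
Proof.
move=> c0 s0 key; have [h1|hn] := ltP 0 s.
  have := key s^-1; rewrite -(ler_pM2r h1) mul0r.
  suff -> : (e - 2 * s^-1 * c + s^-1 ^+ 2 * c * s) * s = e * s - c by rewrite subr_ge0.
  by field; rewrite gt_eqF.
have sE : s = 0 by apply/eqP; rewrite eq_le hn s0.
rewrite sE mulr0 leNgt; apply/negP => cpos.
(* This [t] turns the expression into [- e - 2], which is negative since [t = 0] gives [0 <= e]. *)
have := key ((e + 1) / c).
have := key 0; rewrite sE !mulr0 mul0r subr0 addr0 => e0.
rewrite addr0 -mulrA divfK ?gt_eqF//; lra.
Qed.

(** * Square-integrable functions, inner product and Cauchy-Schwarz *)

Section square_integrable.
Variable R : realType.
Implicit Types (f g h : circle R -> R[i]) (a : R[i]).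
Local Notation mu := (arc_measure R).

Definition sqintegrable f := circle_measurable f /\
  mu.-integrable setT (fun w => (modulus (f (cis w)) ^+ 2)%:E).

Definition sqnorm f : R := Rintegral mu setT (fun w => modulus (f (cis w)) ^+ 2).

Lemma measurable_sqmodulus f : circle_measurable f ->
  measurable_fun [set: R] (fun w => (modulus (f (cis w)) ^+ 2)%:E).
Proof.
move=> mf; apply/measurable_EFinP.
exact: (measurable_funX 2 (measurable_modulus mf)).
Qed.

Lemma sqnorm_ge0 f : 0 <= sqnorm f.
Proof. by apply: Rintegral_ge0 => w _; exact: sqr_ge0. Qed.

Lemma sqintegrable_lty f : circle_measurable f ->
  (\int[mu]_w (modulus (f (cis w)) ^+ 2)%:E < +oo)%E -> sqintegrable f.
Proof.
move=> mf fi; split => //; apply/integrableP; split; first exact: measurable_sqmodulus.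
by under eq_integral do rewrite gee0_abs ?lee_fin ?sqr_ge0//.
Qed.

Lemma sqnormE f : sqintegrable f ->
  (\int[mu]_w (modulus (f (cis w)) ^+ 2)%:E)%E = (sqnorm f)%:E.
Proof.
by move=> [_ fi]; rewrite /sqnorm /Rintegral fineK//; exact: integrable_fin_num.
Qed.

Lemma Lp_norm2E f : Lp_norm 2%:E f =
  ((\int[mu]_w (modulus (f (cis w)) ^+ 2)%:E) `^ (2^-1))%E.
Proof.
rewrite /Lp_norm unlock; congr (_ `^ _)%E; apply: eq_integral => w _.
by rewrite gee0_abs ?lee_fin ?modulus_ge0// poweR_EFin powR_mulrn// modulus_ge0.
Qed.

Lemma Lp_norm2 f : sqintegrable f -> Lp_norm 2%:E f = (Num.sqrt (sqnorm f))%:E.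
Proof.
by move=> fi; rewrite Lp_norm2E sqnormE// poweR_EFin powR12_sqrt// sqnorm_ge0.
Qed.

Lemma Lp2P f : Lp 2%:E f <-> sqintegrable f.
Proof.
split => [[mf]|fi]; last by split; [case: fi|rewrite Lp_norm2// ltry].
rewrite Lp_norm2E => fi; apply: sqintegrable_lty => //.
rewrite ltey; apply/eqP => foo; move: fi.
by rewrite foo poweRyr ?ltxx// invr_eq0 pnatr_eq0.
Qed.

Lemma sqintegrable_le f g : circle_measurable f -> sqintegrable g ->
  (forall z, modulus (f z) <= modulus (g z)) -> sqintegrable f.
Proof.
move=> mf [mg ig] fg; split => //.
apply: le_integrable ig => //; first exact: measurable_sqmodulus.
move=> w _ /=; rewrite lee_fin !ger0_norm ?sqr_ge0//.
by rewrite lerXn2r ?nnegrE ?modulus_ge0.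
Qed.

Lemma sqintegrableZ a f : sqintegrable f -> sqintegrable (fun z => a * f z).
Proof.
move=> [mf fi]; split.
  by apply: circle_measurableM => //; exact: circle_measurable_cst.
under eq_fun do rewrite modulusM exprMn EFinM.
exact: integrableZl.
Qed.

Lemma sqintegrableD f g : sqintegrable f -> sqintegrable g ->
  sqintegrable (fun z => f z + g z).
Proof.
move=> [mf fi] [mg gi]; split; first exact: circle_measurableD.
have := integrableD measurableT (integrableZl measurableT 2 fi) (integrableZl measurableT 2 gi).
apply: le_integrable => //; first exact: (measurable_sqmodulus (circle_measurableD mf mg)).
move=> w _ /=; rewrite !lee_fin !ger0_norm ?addr_ge0 ?mulr_ge0 ?sqr_ge0 ?modulus_ge0//.
exact: sqr_modulusD_le.
Qed.

Lemma sqintegrableN f : sqintegrable f -> sqintegrable (fun z => - f z).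
Proof. by move=> /(sqintegrableZ (-1)); under eq_fun do rewrite mulN1r. Qed.

Lemma sqintegrableB f g : sqintegrable f -> sqintegrable g ->
  sqintegrable (fun z => f z - g z).
Proof. by move=> fi /sqintegrableN; exact: sqintegrableD. Qed.

Lemma sqintegrable_conj f : sqintegrable f -> sqintegrable (fun z => (f z)^*%C).
Proof.
move=> [mf fi]; split; first exact: circle_measurable_conj.
by under eq_fun do rewrite modulus_conj.
Qed.

Lemma sqintegrable_cst a : sqintegrable (fun=> a).
Proof.
apply: sqintegrable_lty; first exact: circle_measurable_cst.
by rewrite integral_cst//= arc_measureT mule1 ltry.
Qed.

Lemma cintegrable_mul f g : sqintegrable f -> sqintegrable g ->
  cintegrable (fun z => f z * g z).
Proof.
move=> [mf fi] [mg gi]; split; first exact: circle_measurableM.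
have := integrableD measurableT fi gi.
apply: le_integrable => //; first exact: (emeasurable_modulus (circle_measurableM mf mg)).
move=> w _ /=; rewrite !lee_fin !ger0_norm ?addr_ge0 ?sqr_ge0 ?modulus_ge0// modulusM.
set x := modulus _; set y := modulus _.
have := sqr_ge0 (x - y); have := sqr_ge0 x; have := sqr_ge0 y; nra.
Qed.

Lemma sqintegrable_cintegrable f : sqintegrable f -> cintegrable f.
Proof.
move=> fi; have := cintegrable_mul fi (sqintegrable_cst 1).
by under eq_fun do rewrite mulr1.
Qed.

Lemma sqnorm_eq0 f : sqintegrable f -> sqnorm f = 0 -> ae_zero f.
Proof.
move=> fi f0.
have : (\int[mu]_w `|(modulus (f (cis w)) ^+ 2)%:E| = 0)%E.
  under eq_integral do rewrite gee0_abs ?lee_fin ?sqr_ge0//.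
  by rewrite sqnormE// f0.
move/ae_eq_integral_abs => /(_ measurableT).
case: fi => mf _ /(_ (measurable_sqmodulus mf)).
move=> /ae_imp; apply => w /(_ I) [] /eqP; rewrite sqrf_eq0 modulus_eq0.
by move/eqP.
Qed.

Lemma sqnorm_ae f g : circle_measurable f -> circle_measurable g ->
  {ae mu, forall w, modulus (f (cis w)) = modulus (g (cis w))} -> sqnorm f = sqnorm g.
Proof.
move=> mf mg fg; rewrite /sqnorm /Rintegral; congr fine.
apply: ae_eq_integral => //; do ?exact: measurable_sqmodulus.
by apply: (ae_imp fg) => w ->.
Qed.

Lemma sqintegrable_bounded_mul h f (M : R) : circle_measurable h ->
  {ae mu, forall w, modulus (h (cis w)) <= M} -> sqintegrable f ->
  sqintegrable (fun z => h z * f z) /\ sqnorm (fun z => h z * f z) <= M ^+ 2 * sqnorm f.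
Proof.
move=> mh hM fi; have mf := fi.1.
have le : (\int[mu]_w (modulus (h (cis w) * f (cis w)) ^+ 2)%:E <= (M ^+ 2 * sqnorm f)%:E)%E.
  rewrite EFinM -sqnormE// -ge0_integralZl_EFin ?sqr_ge0//; last 2 first.
  - by move=> w _; rewrite lee_fin sqr_ge0.
  - exact: measurable_sqmodulus.
  apply: ae_ge0_le_integral => //.
  - by move=> w _; rewrite lee_fin sqr_ge0.
  - exact: (measurable_sqmodulus (circle_measurableM mh mf)).
  - by move=> w _; rewrite -EFinM lee_fin mulr_ge0 ?sqr_ge0.
  - by apply: measurable_funeM; exact: measurable_sqmodulus.
  - apply: (ae_imp hM) => w hwM _; rewrite -EFinM lee_fin modulusM exprMn.
    rewrite ler_wpM2r ?sqr_ge0// lerXn2r ?nnegrE ?modulus_ge0//.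
    exact: le_trans (modulus_ge0 _) hwM.
have hfi : sqintegrable (fun z => h z * f z).
  apply: sqintegrable_lty; first exact: circle_measurableM.
  by apply: le_lt_trans le _; rewrite ltry.
by split => //; rewrite -lee_fin -sqnormE.
Qed.

Lemma sqintegrable_bounded f (M : R) : circle_measurable f ->
  {ae mu, forall w, modulus (f (cis w)) <= M} -> sqintegrable f.
Proof.
move=> mf fM; have [+ _] := sqintegrable_bounded_mul mf fM (sqintegrable_cst 1).
by under eq_fun do rewrite mulr1.
Qed.

Lemma innerE f h : inner f h = circle_integral (fun z => f z * (h z)^*%C).
Proof. by []. Qed.

Lemma inner_linear a f g h : sqintegrable f -> sqintegrable g -> sqintegrable h ->
  inner (fun z => a * f z + g z) h = a * inner f h + inner g h.
Proof.
move=> fi gi hi; rewrite !innerE.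
under [fun z => _]eq_fun do rewrite mulrDl -mulrA.
have fhi := cintegrable_mul fi (sqintegrable_conj hi).
have ghi := cintegrable_mul gi (sqintegrable_conj hi).
by rewrite circle_integralD ?circle_integralZ//; exact: cintegrableZ.
Qed.

Lemma inner_conj f h : sqintegrable f -> sqintegrable h -> inner h f = (inner f h)^*%C.
Proof.
move=> fi hi; rewrite !innerE -circle_integral_conj; last first.
  exact: cintegrable_mul fi (sqintegrable_conj hi).
by congr circle_integral; apply/funext => z; rewrite rmorphM /= conjcK mulrC.
Qed.

Lemma inner_self f : inner f f = (sqnorm f)%:C.
Proof.
rewrite !innerE /sqnorm -(circle_integral_real (fun z => modulus (f z) ^+ 2)).
by congr circle_integral; apply/funext => z; rewrite mul_conj.
Qed.

Lemma innerD f g h : sqintegrable f -> sqintegrable g -> sqintegrable h ->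
  inner (fun z => f z + g z) h = inner f h + inner g h.
Proof.
move=> fi gi hi; have := inner_linear 1 fi gi hi.
by under eq_fun do rewrite mul1r; rewrite mul1r.
Qed.

Lemma innerZ a f h : sqintegrable f -> sqintegrable h ->
  inner (fun z => a * f z) h = a * inner f h.
Proof.
move=> fi hi; rewrite !innerE -circle_integralZ; last first.
  exact: cintegrable_mul fi (sqintegrable_conj hi).
by congr circle_integral; apply/funext => z; rewrite mulrA.
Qed.

Lemma innerB f g h : sqintegrable f -> sqintegrable g -> sqintegrable h ->
  inner (fun z => f z - g z) h = inner f h - inner g h.
Proof.
move=> fi gi hi; have := innerD fi (sqintegrableZ (-1) gi) hi.
rewrite innerZ// mulN1r => <-; congr (inner _ h).
by apply/funext => z; rewrite mulN1r.
Qed.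

Lemma innerDr f g h : sqintegrable f -> sqintegrable g -> sqintegrable h ->
  inner h (fun z => f z + g z) = inner h f + inner h g.
Proof.
move=> fi gi hi; rewrite inner_conj//; last exact: sqintegrableD.
by rewrite innerD// [inner h f]inner_conj// [inner h g]inner_conj// rmorphD.
Qed.

Lemma innerZr a f h : sqintegrable f -> sqintegrable h ->
  inner h (fun z => a * f z) = a^*%C * inner h f.
Proof.
move=> fi hi; rewrite inner_conj//; last exact: sqintegrableZ.
by rewrite innerZ// [inner h f]inner_conj// rmorphM.
Qed.

Lemma sqnormD a f h : sqintegrable f -> sqintegrable h ->
  sqnorm (fun z => f z + a * h z) =
  sqnorm f + 2 * complex.Re (a^*%C * inner f h) + modulus a ^+ 2 * sqnorm h.
Proof.
move=> fi hi; apply: (@complexI R).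
have ahi := sqintegrableZ a hi.
have faf := sqintegrableD fi ahi.
rewrite -inner_self (innerD fi ahi faf) (innerZ a hi faf) !innerDr// !innerZr// !inner_self.
rewrite [inner h f]inner_conj// sqr_modulus.
case: (inner f h) a {ahi faf} => x y [u v].
by apply: complex_eq => /=; ring.
Qed.

Lemma cauchy_schwarz f h : sqintegrable f -> sqintegrable h ->
  modulus (inner f h) ^+ 2 <= sqnorm f * sqnorm h.
Proof.
move=> fi hi; have f0 := sqnorm_ge0 f; have h0 := sqnorm_ge0 h.
set c := inner f h.
(* The multiplier [- t c] carries the phase of the inner product, so the cross term becomes
   [- 2 t |c|^2] and both [t]-terms share the factor [|c|^2]. *)
have key (t : R) : 0 <= sqnorm f - 2 * t * modulus c ^+ 2 + t ^+ 2 * modulus c ^+ 2 * sqnorm h.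
  have := sqnorm_ge0 (fun z => f z + (- t%:C * c) * h z).
  rewrite sqnormD// -/c modulusM modulusN modulusR exprMn real_normK ?num_real//.
  suff -> : complex.Re ((- t%:C * c)^*%C * c) = - t * modulus c ^+ 2.
    by rewrite mulNr mulrN mulrA.
  by rewrite sqr_modulus; case: c => x y /=; ring.
exact: quadratic_bound (sqr_ge0 _) h0 key.
Qed.

End square_integrable.

(** * Projections in L2 *)

Section hilbert.
Variable R : realType.
Implicit Types (f g h : circle R -> R[i]) (a : R[i]) (S : set (circle R -> R[i])).
Local Notation mu := (arc_measure R).

Lemma sqintegrable_complete (u : nat -> circle R -> R[i]) :
  (forall n, sqintegrable (u n)) ->
  (forall e : R, 0 < e -> exists N, forall n m, (N <= n)%N -> (N <= m)%N ->
    sqnorm (fun z => u n z - u m z) <= e) ->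
  exists phi, sqintegrable phi /\ forall e : R, 0 < e -> exists N, forall n,
    (N <= n)%N -> sqnorm (fun z => u n z - phi z) <= e.
Proof.
move=> ui uC.
have muT : (mu setT < +oo)%E by rewrite arc_measureT ltry.
have mui n := (ui n).1.
have part (P : R[i] -> R) : (forall n, measurable_fun [set: R] (fun w => P (u n (cis w)))) ->
    (forall z w, (P z - P w) ^+ 2 <= modulus (z - w) ^+ 2) ->
    forall e : R, 0 < e -> exists N, forall n m, (N <= n)%N -> (N <= m)%N ->
    (\int[mu]_w ((P (u n (cis w)) - P (u m (cis w))) ^+ 2)%:E <= e%:E)%E.
  move=> mP Ple e /uC[N HN]; exists N => n m Nn Nm.
  apply: (@le_trans _ _ (sqnorm (fun z => u n z - u m z))%:E); last by rewrite lee_fin HN.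
  rewrite -sqnormE; last exact: sqintegrableB.
  apply: ge0_le_integral => //.
  - by move=> w _; rewrite lee_fin sqr_ge0.
  - exact: (emeasurable_sqrB (mP n) (mP m)).
  - exact: (measurable_sqmodulus (circle_measurableB (mui n) (mui m))).
  - by move=> w _; rewrite lee_fin.
have Rele (z w : R[i]) : (complex.Re z - complex.Re w) ^+ 2 <= modulus (z - w) ^+ 2.
  by rewrite sqr_modulus !RecImcE lerDl sqr_ge0.
have Imle (z w : R[i]) : (complex.Im z - complex.Im w) ^+ 2 <= modulus (z - w) ^+ 2.
  by rewrite sqr_modulus !RecImcE lerDr sqr_ge0.
have [L1 [mL1 HL1]] := real_L2_complete muT (fun n => (mui n).1)
  (part _ (fun n => (mui n).1) Rele).
have [L2 [mL2 HL2]] := real_L2_complete muT (fun n => (mui n).2)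
  (part _ (fun n => (mui n).2) Imle).
pose phi z := L1 (fun n => complex.Re (u n z)) +i* L2 (fun n => complex.Im (u n z)).
have mphi : circle_measurable phi by [].
have bound e : 0 < e -> exists N, forall n, (N <= n)%N ->
    (\int[mu]_w (modulus (u n (cis w) - phi (cis w)) ^+ 2)%:E <= e%:E)%E.
  move=> e0; have e2 : 0 < e / 2 by rewrite divr_gt0.
  have [N1 H1] := HL1 _ e2; have [N2 H2] := HL2 _ e2.
  exists (maxn N1 N2) => n; rewrite geq_max => /andP[/H1{}H1 /H2{}H2].
  under eq_integral do rewrite sqr_modulus !RecImcE EFinD.
  rewrite ge0_integralD//.
  - by rewrite (splitr e) EFinD leeD.
  - by move=> w _; rewrite lee_fin sqr_ge0.
  - exact: (emeasurable_sqrB (mui n).1 mphi.1).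
  - by move=> w _; rewrite lee_fin sqr_ge0.
  - exact: (emeasurable_sqrB (mui n).2 mphi.2).
have [N1 H1] := bound 1 ltr01.
have uphi : sqintegrable (fun z => u N1 z - phi z).
  apply: sqintegrable_lty; first exact: circle_measurableB.
  by apply: le_lt_trans (H1 N1 (leqnn _)) _; rewrite ltry.
have phii : sqintegrable phi.
  have := sqintegrableB (ui N1) uphi.
  by under eq_fun do rewrite opprB addrC subrK.
exists phi; split => // e /bound[N HN]; exists N => n Nn.
by rewrite -lee_fin -sqnormE; [exact: HN|exact: sqintegrableB].
Qed.

Definition L2closure S : set (circle R -> R[i]) := [set phi | sqintegrable phi /\
  forall e : R, 0 < e -> exists s, S s /\ sqnorm (fun z => s z - phi z) < e].

Lemma sqnormZ a f : sqintegrable f -> sqnorm (fun z => a * f z) = modulus a ^+ 2 * sqnorm f.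
Proof.
move=> fi; rewrite /sqnorm; under eq_Rintegral do rewrite modulusM exprMn.
by rewrite RintegralZl//; case: fi.
Qed.

Lemma sqnormN f : sqnorm (fun z => - f z) = sqnorm f.
Proof. by apply: eq_Rintegral => w _; rewrite modulusN. Qed.

Lemma sqnormBC f g : sqnorm (fun z => f z - g z) = sqnorm (fun z => g z - f z).
Proof. by apply: eq_Rintegral => w _; rewrite modulusB. Qed.

(** Written with the midpoint, so that the right-hand side is the defect [D] of [convex_min_seq]:
    small defects mean a Cauchy sequence. *)
Lemma sqnorm_parallelogram f g : sqintegrable f -> sqintegrable g ->
  sqnorm (fun z => f z - g z) = 2 * sqnorm f + 2 * sqnorm g -
    4 * sqnorm (fun z => 2^-1 * (f z + g z)).
Proof.
move=> fi gi; rewrite sqnormZ; last exact: sqintegrableD.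
have -> : (fun z => f z + g z) = (fun z => f z + 1 * g z) by apply/funext => z; rewrite mul1r.
have -> : (fun z => f z - g z) = (fun z => f z + -1 * g z) by apply/funext => z; rewrite mulN1r.
rewrite !sqnormD// modulusN rmorphN !rmorph1 mulN1r !mul1r RecN.
have -> : modulus (1 : R[i]) = 1 by rewrite modulusE Normc.normc1.
have -> : modulus (2^-1 : R[i]) = 2^-1.
  by rewrite (_ : 2^-1 = (2^-1 : R)%:C) ?modulusR ?ger0_norm// fmorphV rmorph_nat.
by rewrite expr1n; field.
Qed.

Lemma sqnorm_triangle f g : sqintegrable f -> sqintegrable g ->
  sqnorm (fun z => f z + g z) <= 2 * sqnorm f + 2 * sqnorm g.
Proof.
move=> fi gi; have := sqnorm_parallelogram fi (sqintegrableN gi).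
under eq_fun do rewrite opprK; move=> ->.
by rewrite sqnormN lerBlDr lerDl mulr_ge0// sqnorm_ge0.
Qed.

(** Pairing with [h] is continuous by Cauchy-Schwarz. The value [a] is arbitrary because the
    relation carried over is sometimes a normalization, such as a prescribed mean or leading
    coefficient. *)
Lemma inner_L2closure S phi h a : (forall s, S s -> sqintegrable s /\ inner s h = a) ->
  sqintegrable h -> L2closure S phi -> inner phi h = a.
Proof.
move=> Sh hi [phii phiS]; apply/eqP; rewrite -subr_eq0 -modulus_eq0; apply/eqP.
apply/eqP; rewrite -sqrf_eq0 eq_le sqr_ge0 andbT.
apply/ler_addgt0Pl => e e0; rewrite addr0.
have h1 : 0 < sqnorm h + 1 by rewrite ltr_wpDl// sqnorm_ge0.
have [s [Ss]] := phiS _ (divr_gt0 e0 h1).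
have [si <-] := Sh _ Ss.
rewrite sqnormBC ltr_pdivlMr// => lt.
rewrite -innerB//; apply: le_trans (cauchy_schwarz (sqintegrableB phii si) hi) _.
apply: ltW; apply: le_lt_trans lt; rewrite ler_wpM2l ?sqnorm_ge0//.
by rewrite lerDl.
Qed.

Lemma L2closure_seq S (u : nat -> circle R -> R[i]) phi : sqintegrable phi ->
  (forall n, S (u n)) ->
  (forall e : R, 0 < e -> exists N, forall n, (N <= n)%N -> sqnorm (fun z => u n z - phi z) <= e)
      ->
  L2closure S phi.
Proof.
move=> phii Su uphi; split => // e e0.
have /uphi[N HN] : 0 < e / 2 by rewrite divr_gt0.
exists (u N); split => //; apply: le_lt_trans (HN N (leqnn N)) _.
by rewrite ltr_pdivrMr// ltr_pMr// ltr1n.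
Qed.

(** [S] is not assumed closed; the projection lives in its closure. Spans of polynomial multiples
    can thus be used as they are. The minimization takes [q2 = 0], since the distance to [f] already
    controls [s]. *)
Lemma orthogonal_projection S f : sqintegrable f -> S (fun=> 0) ->
  (forall s, S s -> sqintegrable s) ->
  (forall a s t, S s -> S t -> S (fun z => a * s z + t z)) ->
  exists h, L2closure S h /\ forall s, S s -> inner (fun z => f z - h z) s = 0.
Proof.
move=> fi S0 Si Slin.
pose q s := sqnorm (fun z => f z - s z).
pose mid (s t : circle R -> R[i]) : circle R -> R[i] := fun z => 2^-1 * s z + 2^-1 * t z.
have Smid s t : S s -> S t -> S (mid s t).
  move=> Ss St; apply: (Slin 2^-1) => //.
  by have := Slin 2^-1 _ _ St S0; under eq_fun do rewrite addr0.
have fsi s : S s -> sqintegrable (fun z => f z - s z) by move=> /Si; exact: sqintegrableB.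
have par s t : S s -> S t ->
    2 * q s + 2 * q t - 4 * q (mid s t) = sqnorm (fun z => s z - t z).
  move=> Ss St; rewrite [RHS]sqnormBC.
  have -> : (fun z => t z - s z) = (fun z => (f z - s z) - (f z - t z)).
    by apply/funext => z; ring.
  rewrite sqnorm_parallelogram//; try exact: fsi.
  rewrite /q; congr (_ - 4 * sqnorm _); apply/funext => z; rewrite /mid.
  have E (k x y w : R[i]) : k * 2 = 1 -> x - (k * y + k * w) = k * ((x - y) + (x - w)).
    move=> k2; transitivity (k * 2 * x - (k * y + k * w)); last by ring.
    by rewrite k2 mul1r.
  by apply: E; rewrite mulVf// pnatr_eq0.
have [] := @convex_min_seq R _ S q (fun=> 0) mid 0.
- by exists (fun=> 0).
- exact: Smid.
- by move=> s _; exact: sqnorm_ge0.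
- by move=> s _; rewrite lexx.
- by move=> s t Ss St /=; rewrite par// sqnorm_ge0.
- by move=> s t _ _ /=; rewrite !mulr0 addr0 subr0.
move=> d [u [dmin Su uC]].
have ui n := Si _ (Su n).
have [e e0|h [hi uh]] := @sqintegrable_complete u ui.
  have [N HN] := uC _ e0; exists N => n m Nn Nm.
  by have [_ + _] := HN n m Nn Nm; rewrite par// => /ltW.
exists h; split; first exact: L2closure_seq hi Su uh.
move=> s Ss; have si := Si _ Ss.
have dlt e : 0 < e -> exists n, q (u n) < d + e /\ sqnorm (fun z => u n z - h z) <= e.
  move=> e0; have [N1 H1] := uC _ e0; have [N2 H2] := uh _ e0.
  exists (maxn N1 N2); split; last by rewrite H2// leq_maxr.
  by have [] := H1 (maxn N1 N2) (maxn N1 N2) (leq_maxl _ _) (leq_maxl _ _).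
(* Approximate first-order condition: moving a near-minimizer [t] along [s] cannot bring the squared
   distance below [d], so the residual is nearly orthogonal to [s]. *)
have small (t : circle R -> R[i]) e : S t -> q t < d + e -> modulus (inner (fun z => f z - t z)
    s) ^+ 2 <= e * sqnorm s.
  move=> St qt; set c := inner _ _.
  have key (k : R) : 0 <= e - 2 * k * modulus c ^+ 2 + k ^+ 2 * modulus c ^+ 2 * sqnorm s.
    have := dmin _ (Slin (k%:C * c) s t Ss St); rewrite /q.
    have -> : (fun z => f z - (k%:C * c * s z + t z)) = (fun z => (f z - t z) + (- (k%:C * c)) *
        s z).
      by apply/funext => z; ring.
    rewrite sqnormD//; last exact: fsi.
    rewrite -/c modulusN modulusM modulusR exprMn real_normK ?num_real//.
    have -> : complex.Re ((- (k%:C * c))^*%C * c) = - k * modulus c ^+ 2.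
      by rewrite sqr_modulus; case: c => x y /=; ring.
    move: qt; rewrite /q; lra.
  exact: quadratic_bound (sqr_ge0 _) (sqnorm_ge0 s) key.
apply/eqP; rewrite -modulus_eq0 -sqrf_eq0 eq_le sqr_ge0 andbT.
apply/ler_addgt0Pl => e e0; rewrite addr0.
(* Both squared errors become at most [e / 4], and squaring the sum of two terms costs a factor 2 on
   each. *)
have s1 : 0 < 4 * (sqnorm s + 1) by rewrite mulr_gt0// ltr_wpDl// sqnorm_ge0.
have [n [qn un]] := dlt _ (divr_gt0 e0 s1).
have uhi := sqintegrableB (ui n) hi.
have -> : inner (fun z => f z - h z) s = inner (fun z => f z - u n z) s + inner (fun z => u n z -
    h z) s.
  rewrite -innerD//; last exact: fsi.
  by congr inner; apply/funext => z; ring.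
apply: le_trans (sqr_modulusD_le _ _) _.
have h1 := small _ _ (Su n) qn.
have h2 := cauchy_schwarz uhi si.
have h3 := ler_wpM2r (sqnorm_ge0 s) un.
have : e / (4 * (sqnorm s + 1)) * sqnorm s <= e / 4.
  rewrite invfM !mulrA -mulrA ler_piMr ?divr_ge0 ?ltW//.
  by rewrite mulrC ltr_pdivrMr ?mul1r ?ltrDl// ltr_wpDl// sqnorm_ge0.
lra.
Qed.

End hilbert.

(** * Fourier coefficients *)

Section arc_measure_lebesgue.
Variable R : realType.
Local Notation mu := (arc_measure R).
Local Notation lambda := (@lebesgue_measure R).
Local Notation arc := (`[(- pi)%R, pi[%classic : set R).
Implicit Types (A : set R) (f : R -> \bar R).

Let k_gt0 : 0 < (2 * pi)^-1 :> R.
Proof. by rewrite invr_gt0 mulr_gt0// pi_gt0. Qed.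

Lemma ge0_integral_arc A f : measurable A -> measurable_fun setT f -> (forall x, (0 <= f x)%E) ->
  (\int[mu]_(x in A) f x = ((2 * pi)^-1)%:E * \int[lambda]_(x in A `&` arc) f x)%E.
Proof.
move=> mA mf f0; have mD : measurable (A `&` arc) by apply: measurableI.
have mAD : measurable (A `\` arc) by apply: measurableD.
rewrite -[in LHS](setUIDK A arc) ge0_integral_setU//; last 2 first.
- by rewrite setUIDK; exact: measurable_funTS.
- by rewrite disj_set2E; apply/eqP; rewrite setDE setIACA setICr setI0.
rewrite [X in (_ + X)%E](_ : _ = 0%E) ?adde0; last first.
  rewrite (@ge0_negligible_integral _ _ _ mu _ (A `\` arc)) ?setDv ?integral_set0//.
    exact: measurable_funTS.
  by rewrite arc_measureE setDE -setIA setICl setI0 measure0 mule0.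
rewrite -(@ge0_integral_mscale _ _ _ lambda _ mD (NngNum (invr_2pi_ge0 R)))//; last first.
  exact: measurable_funTS.
apply: eq_measure_integral => B mB BD.
rewrite arc_measureE -[RHS]/(_ * lambda B)%E; congr (_ * lambda _)%E.
by apply/setIidPl => x /BD[].
Qed.

Lemma ae_arc (P : R -> Prop) : {ae mu, forall w, P w} ->
  {ae lambda, forall w, arc w -> P w}.
Proof.
move=> [N [mN N0 PN]]; exists (N `&` arc); split; first exact: measurableI.
  move: N0; rewrite arc_measureE => /eqP; rewrite mule_eq0 => /orP[/eqP[]/eqP|/eqP//].
  by rewrite gt_eqF.
by move=> w /= /not_implyP[wa nP]; split => //; apply: PN.
Qed.

Lemma arc_ae (P : R -> Prop) : {ae lambda, forall w, arc w -> P w} ->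
  {ae mu, forall w, P w}.
Proof.
move=> [N [mN N0 PN]]; exists (N `|` ~` arc); split.
- by apply: measurableU => //; exact: measurableC.
- rewrite arc_measureE setIUl setICl setU0 (_ : lambda _ = 0%E) ?mule0//.
  by apply: (subset_measure0 _ mN) => //; exact: measurableI.
- by move=> w nP; have [wa|] := pselect (arc w); [left; apply: PN => /(_ wa)|right].
Qed.

Lemma ae_arc_interior (P : R -> Prop) : (forall w, - pi < w < pi -> P w) ->
  {ae mu, forall w, P w}.
Proof.
move=> h; apply: arc_ae; exists [set - pi]; split => //; first exact: lebesgue_measure_set1.
move=> w /= /not_implyP[]; rewrite in_itv /= => /andP[piw wpi] nP.
apply/eqP; apply: contra_notT nP => wpi'; apply: h.
by rewrite wpi lt_neqAle eq_sym wpi' piw.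
Qed.

Lemma integrable_arc A f : measurable A -> measurable_fun setT f ->
  mu.-integrable A f <-> lambda.-integrable (A `&` arc) f.
Proof.
move=> mA mf.
have mD : measurable (A `&` arc) by apply: measurableI.
have E := ge0_integral_arc mA (measurableT_comp (@abse_measurable _ setT) mf) (fun x => abse_ge0
    (f x)).
split=> /integrableP[_ fi]; apply/integrableP; split; try exact: measurable_funTS.
  move: fi; rewrite E => fi; rewrite ltey; apply/eqP => foo.
  by move: fi; rewrite foo gt0_muley ?ltxx// lte_fin.
by rewrite E lte_mul_pinfty// ?lee_fin ?ltW//.
Qed.

Lemma Rintegral_arc A (f : R -> R) : measurable A -> measurable_fun setT f ->
  mu.-integrable A (EFin \o f) ->
  Rintegral mu A f = (2 * pi)^-1 * Rintegral lambda (A `&` arc) f.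
Proof.
move=> mA mf fi.
have mEf : measurable_fun setT (EFin \o f) by apply/measurable_EFinP.
have mD : measurable (A `&` arc : set (measurableTypeR R)) by apply: measurableI.
have li := (integrable_arc mA mEf).1 fi.
rewrite /Rintegral -[RHS]/(fine ((2 * pi)^-1)%:E * _) -fineM//; last exact: integrable_fin_num.
congr fine; rewrite [in LHS]integralE [in RHS]integralE.
rewrite !ge0_integral_arc//; try exact: measurable_funepos; try exact: measurable_funeneg.
by rewrite [RHS]muleBr//; exact: (integrable_add_def mD li).
Qed.

Lemma lebesgue_measure_I1 A x : lambda (A `&` [set x]) = 0%E.
Proof.
have [Ax|nAx] := pselect (A x).
  by rewrite setIidr ?lebesgue_measure_set1// => _ ->.
by rewrite (_ : _ `&` _ = set0) ?measure0// -subset0 => y [] /[swap] ->.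
Qed.

(** Reflection sends [[-pi, pi)] to [(-pi, pi]]. Each is the open interval plus one endpoint, and
    the endpoints are null. *)
Lemma arc_measureN A : measurable A ->
  pushforward mu (-%R : _ -> measurableTypeR R) A = mu A.
Proof.
move=> mA; rewrite /pushforward !arc_measureE; congr (_ * _)%E.
have mo : measurable (A `&` `](- pi)%R, pi[) by apply: measurableI.
have -> : A `&` arc = (A `&` `](- pi)%R, pi[) `|` (A `&` [set - pi]).
  rewrite -setIUr; congr (_ `&` _).
  by rewrite setUC setU1itv// bnd_simp gtrN ?pi_gt0.
rewrite measureU0//; last 2 first.
- by apply: measurableI.
- exact: lebesgue_measure_I1.
have -> : (-%R : R -> R) @^-1` A `&` arc =
    (-%R : _ -> measurableTypeR R) @^-1` ((A `&` `](- pi)%R, pi[) `|` (A `&` [set pi])).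
  rewrite -setIUr preimage_setI; congr (_ `&` _).
  rewrite setUitv1 ?bnd_simp ?gtrN ?pi_gt0//.
  by rewrite opp_preimage_itvbndbnd/= opprK.
have mpi : measurable (A `&` [set pi]) by apply: measurableI.
rewrite -[LHS]/(pushforward lambda (-%R : _ -> measurableTypeR R) _) lebesgue_measureN; last
    exact: measurableU.
rewrite measureU0//.
exact: lebesgue_measure_I1.
Qed.

End arc_measure_lebesgue.

Section fourier.
Variable R : realType.
Implicit Types (f g h : circle R -> R[i]) (a : R[i]).
Local Notation mu := (arc_measure R).
Local Notation lambda := (@lebesgue_measure R).
Local Notation arc := (`[(- pi)%R, pi[%classic : set R).

Lemma ge0_integral_arcN (f : R -> \bar R) : measurable_fun setT f ->
  (forall x, (0 <= f x)%E) -> (\int[mu]_x f (- x)%R = \int[mu]_x f x)%E.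
Proof.
move=> mf f0.
have mN : measurable_fun setT (-%R : measurableTypeR R -> measurableTypeR R).
  exact: measurable_funN.
rewrite -[LHS](@ge0_integral_pushforward _ _ _ _ _ _ mN mu setT f)//.
by apply: eq_measure_integral => A mA _; exact: arc_measureN.
Qed.

Lemma Rintegral_arcN (f : R -> R) : measurable_fun setT f ->
  mu.-integrable setT (EFin \o f) -> mu.-integrable setT (fun x => (f (- x))%:E) /\
  Rintegral mu setT (fun x => f (- x)) = Rintegral mu setT f.
Proof.
move=> mf fi.
have mN : measurable_fun setT (-%R : measurableTypeR R -> measurableTypeR R).
  exact: measurable_funN.
have mEf : measurable_fun setT (EFin \o f) by exact/measurable_EFinP.
have iN : mu.-integrable setT (fun x => (f (- x))%:E).
  apply/integrableP; split; first exact: (measurableT_comp mEf mN).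
  case/integrableP: fi => _; rewrite -(ge0_integral_arcN (f := fun x => `|(f x)%:E|%E))//.
  by apply: measurableT_comp => //; exact/measurable_EFinP.
split => //; rewrite /Rintegral; congr fine.
rewrite -[LHS](@integral_pushforward _ _ _ _ _ _ mN mu setT (EFin \o f))//.
by apply: eq_measure_integral => A mA _; exact: arc_measureN.
Qed.

Lemma cintegrable_comp_conj f : cintegrable f -> cintegrable (fun z => f (circle_conj z)).
Proof.
move=> [mf fi]; split; first exact: circle_measurable_comp_conj.
under eq_fun do rewrite cisN.
by have [] := Rintegral_arcN (measurable_modulus mf) fi.
Qed.

Lemma circle_integral_comp_conj f : cintegrable f ->
  circle_integral (fun z => f (circle_conj z)) = circle_integral f.
Proof.
move=> fi; rewrite /circle_integral.
under [X in X +i* _]eq_Rintegral do rewrite cisN.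
under [X in _ +i* X]eq_Rintegral do rewrite cisN.
have [[mR mI] _] := fi.
have [_ ->] := Rintegral_arcN mR (integrable_Re fi).
by have [_ ->] := Rintegral_arcN mI (integrable_Im fi).
Qed.

Lemma sqnorm_comp_conj f : circle_measurable f ->
  sqnorm (fun z => f (circle_conj z)) = sqnorm f.
Proof.
move=> mf; rewrite /sqnorm /Rintegral; congr fine.
under eq_integral do rewrite cisN.
rewrite (ge0_integral_arcN (f := fun w => (modulus (f (cis w)) ^+ 2)%:E))//.
  exact: measurable_sqmodulus.
by move=> x; rewrite lee_fin sqr_ge0.
Qed.

Lemma sqintegrable_comp_conj f : sqintegrable f -> sqintegrable (fun z => f (circle_conj z)).
Proof.
move=> [mf fi]; split; first exact: circle_measurable_comp_conj.
under eq_fun do rewrite cisN.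
have mf2 : measurable_fun [set: R] (fun w => modulus (f (cis w)) ^+ 2).
  exact: (measurable_funX 2 (measurable_modulus mf)).
by have [] := Rintegral_arcN mf2 fi.
Qed.

Lemma sval_neq0 (z : circle R) : sval z != 0.
Proof. by rewrite -modulus_eq0 modulus_circle oner_eq0. Qed.

Lemma conj_sval (z : circle R) : (sval z)^*%C = (sval z)^-1.
Proof.
apply: (mulfI (sval_neq0 z)); rewrite divff ?sval_neq0// mul_conj.
by rewrite modulus_circle expr1n.
Qed.

Lemma conj_char (z : circle R) (n : int) : (sval z ^ n)^*%C = sval z ^ (- n).
Proof. by rewrite rmorphXz ?unitfE ?sval_neq0//= conj_sval exprz_inv. Qed.

Lemma modulus_char (z : circle R) (n : int) : modulus (sval z ^ n) = 1.
Proof.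
have mX (m : nat) : modulus (sval z ^+ m) = 1.
  elim: m => [|m IH]; first by rewrite expr0 modulusE Normc.normc1.
  by rewrite exprS modulusM IH modulus_circle mulr1.
by case: n => m; rewrite ?NegzE ?exprNP -?exprnN ?modulusV mX ?invr1.
Qed.

Lemma circle_measurable_char (n : int) : circle_measurable (fun z : circle R => sval z ^ n).
Proof. by apply: circle_measurableXz; exact: circle_measurable_sval. Qed.

Lemma sqintegrable_char (n : int) : sqintegrable (fun z : circle R => sval z ^ n).
Proof.
apply: (sqintegrable_le (circle_measurable_char n) (sqintegrable_cst 1)) => z.
by rewrite modulus_char modulusE Normc.normc1.
Qed.

Lemma cintegrable_char_mul f (n : int) : cintegrable f -> cintegrable (fun z => f z * sval z ^ n).
Proof.
move=> [mf fi]; apply: (@cintegrable_le _ _ f) => //.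
- by apply: circle_measurableM => //; exact: circle_measurable_char.
- by move=> z; rewrite modulusM modulus_char mulr1.
Qed.

Lemma fourierE f (n : int) : fourier f n = inner f (fun z => sval z ^ n).
Proof. by rewrite innerE; congr circle_integral; apply/funext => z; rewrite -conj_char. Qed.

Lemma cisX w (n : int) : sval (@cis R w) ^ n = cos (n%:~R * w) +i* sin (n%:~R * w).
Proof.
have cX (m : nat) : sval (@cis R w) ^+ m = cos (m%:R * w) +i* sin (m%:R * w).
  elim: m => [|m IH]; first by rewrite expr0 mul0r cos0 sin0.
  rewrite exprS IH -natr1 mulrDl mul1r cosD sinD /=.
  by apply: complex_eq => /=; ring.
case: n => m; first exact: cX.
rewrite NegzE -[_ ^ _]conj_char -[_ ^ _]/(_ ^+ _) cX /=.
by rewrite mulrNz mulNr cosN sinN.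
Qed.

Lemma Rintegral_arc_FTC (f F : R -> R) : continuous f ->
  mu.-integrable setT (EFin \o f) -> (forall x : R, is_derive x (1 : R) F (f x)) ->
  F (- pi) = F pi -> Rintegral mu setT f = 0.
Proof.
move=> cf fi Ff Fpi; have mf := continuous_measurable_fun cf.
have dF x : derivable F x (1 : R) by apply: ex_derive.
have cF x : {for x, continuous F}.
  exact/differentiable_continuous/derivable1_diffP.
have mEf : measurable_fun setT (EFin \o f) by exact/measurable_EFinP.
have li : lambda.-integrable arc (EFin \o f).
  by have := (integrable_arc measurableT mEf).1 fi; rewrite setTI.
rewrite Rintegral_arc// setTI Rintegral_itv_bndo_bndc//.
rewrite /Rintegral (@continuous_FTC2 _ f F) ?gtrN ?pi_gt0//.
- by rewrite Fpi subee// mulr0.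
- exact: continuous_subspaceT.
- split => [x _ //||].
  + exact: cvg_at_right_filter (cF _).
  + exact: cvg_at_left_filter (cF _).
- by move=> x _; rewrite derive1E derive_val.
Qed.

Lemma circle_integral_char (n : int) :
  circle_integral (fun z : circle R => sval z ^ n) = (n == 0)%:R.
Proof.
have [->|n0] := eqVneq n 0.
  rewrite /circle_integral /= !Rintegral_cst// arc_measureT /=.
  by rewrite mul0r mul1r.
have k0 : (n%:~R : R) != 0 by rewrite intr_eq0.
have ci := sqintegrable_cintegrable (sqintegrable_char n).
have Ri : mu.-integrable setT (EFin \o (fun w => cos (n%:~R * w))).
  have := integrable_Re ci; rewrite (_ : (fun w => _) = fun w => cos (n%:~R * w))//.
  by apply/funext => w; rewrite cisX.
have Ii : mu.-integrable setT (EFin \o (fun w => sin (n%:~R * w))).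
  have := integrable_Im ci; rewrite (_ : (fun w => _) = fun w => sin (n%:~R * w))//.
  by apply/funext => w; rewrite cisX.
rewrite /circle_integral.
rewrite [X in X +i* _](_ : _ = 0) ?[X in _ +i* X](_ : _ = 0)//.
- under eq_Rintegral do rewrite cisX.
  apply: (@Rintegral_arc_FTC _ (fun x => - cos (n%:~R * x) / n%:~R)) => //.
  + by move=> x; apply: continuous_comp; [exact: mulrl_continuous|exact: continuous_sin].
  + move=> x; apply: is_derive_eq.
    by rewrite /GRing.scale /=; field.
  + by rewrite mulrN cosN.
- under eq_Rintegral do rewrite cisX.
  apply: (@Rintegral_arc_FTC _ (fun x => sin (n%:~R * x) / n%:~R)) => //.
  + by move=> x; apply: continuous_comp; [exact: mulrl_continuous|exact: continuous_cos].
  + move=> x; apply: is_derive_eq.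
    by rewrite /GRing.scale /=; field.
  + have E : @cis R (- pi) = cis pi by apply: val_inj => /=; rewrite cosN sinN sinpi oppr0.
    by have := cisX (- pi) n; rewrite E cisX => -[_ ->].
Qed.


(** Only integrability is required, because uniqueness is later applied to [|phi|^2 - c] with [phi]
    merely in L_2. *)
Definition fourier_null f := cintegrable f /\ forall n, fourier f n = 0.

Lemma fourier_nullD f g : fourier_null f -> fourier_null g ->
  fourier_null (fun z => f z + g z).
Proof.
move=> [fi f0] [gi g0]; split; first exact: cintegrableD.
move=> n; rewrite -[RHS](addr0 0) -{1}(f0 n) -(g0 n) /fourier -circle_integralD.
- by congr circle_integral; apply/funext => z; rewrite mulrDl.
- exact: cintegrable_char_mul.
- exact: cintegrable_char_mul.
Qed.

Lemma fourier_nullM a k f : fourier_null f -> fourier_null (fun z => a * sval z ^ k * f z).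
Proof.
move=> [fi f0]; split.
  under eq_fun do rewrite -mulrA [_ ^ _ * _]mulrC.
  exact/cintegrableZ/cintegrable_char_mul.
move=> n; rewrite -[RHS](mulr0 a) -(f0 (n - k)) /fourier -circle_integralZ.
  congr circle_integral; apply/funext => z.
  by rewrite opprB expfzDr ?sval_neq0//; ring.
exact: cintegrable_char_mul.
Qed.

(* Multiplication by the trigonometric polynomial [1 - s^k] preserves the vanishing of all
   Fourier coefficients; powers of it approximate the indicator of [s < 1/2]. *)
Lemma fourier_null_bump (a b c : R[i]) (s := fun z : circle R => a * sval z ^ 1 + b + c * sval z
    ^ (-1))
    k m f : fourier_null f -> fourier_null (fun z => (1 - s z ^+ k) ^+ m * f z).
Proof.
have sf h : fourier_null h -> fourier_null (fun z => s z * h z).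
  move=> h0; have := fourier_nullD (fourier_nullD (fourier_nullM a 1 h0) (fourier_nullM b 0 h0))
    (fourier_nullM c (-1) h0).
  congr fourier_null; apply/funext => z.
  by rewrite /s expr0z mulr1 !mulrDl.
have skf h j : fourier_null h -> fourier_null (fun z => s z ^+ j * h z).
  move=> h0; elim: j => [|j IH]; first by under eq_fun do rewrite expr0 mul1r.
  by under eq_fun do rewrite exprS -mulrA; exact: sf.
move=> f0; elim: m => [|m IH]; first by under eq_fun do rewrite expr0 mul1r.
have := fourier_nullD IH (fourier_nullM (-1) 0 (skf _ k IH)).
congr fourier_null; apply/funext => z.
by rewrite expr0z mulr1 mulN1r exprS; ring.
Qed.

(** Bernoulli's inequality in two forms: [(1 - t)^m >= 1 - m t] gives the lower bound [1 - (2y)^n]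
    when [y < 1/2], and [(1 + m t) (1 - t)^m <= 1] gives the upper bound [(2y)^-n] when
    [y > 1/2]. *)
Lemma cvg_bump (y : R) : 0 <= y <= 1 -> y != 2^-1 ->
  (1 - y ^+ n) ^+ (2 ^ n)%N @[n --> \oo] --> ((y < 2^-1)%R%:R : R).
Proof.
move=> /andP[y0 y1] y2.
have yn n : 0 <= y ^+ n <= 1 by rewrite exprn_ge0// exprn_ile1.
have b0 n : 0 <= (1 - y ^+ n) ^+ (2 ^ n)%N by rewrite exprn_ge0// subr_ge0; case/andP: (yn n).
have b1 n : (1 - y ^+ n) ^+ (2 ^ n)%N <= 1.
  by have /andP[h1 h2] := yn n; rewrite exprn_ile1 ?subr_ge0// gerBl.
have bern (t : R) m : 0 <= t <= 1 -> 1 - m%:R * t <= (1 - t) ^+ m.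
  move=> /andP[t0 t1]; elim: m => [|m IH]; first by rewrite mul0r subr0 expr0.
  rewrite exprS; have := ler_wpM2l (_ : 0 <= 1 - t) IH; rewrite subr_ge0 => /(_ t1).
  apply: le_trans; rewrite -natr1.
  have : 0 <= m%:R * t ^+ 2 by rewrite mulr_ge0// sqr_ge0.
  lra.
have bern2 (t : R) m : 0 <= t <= 1 -> (1 + m%:R * t) * (1 - t) ^+ m <= 1.
  move=> /andP[t0 t1]; elim: m => [|m IH]; first by rewrite mul0r addr0 expr0 mulr1.
  apply: le_trans IH; rewrite exprS mulrA ler_wpM2r ?exprn_ge0 ?subr_ge0// -natr1.
  have : 0 <= m%:R * t ^+ 2 by rewrite mulr_ge0// sqr_ge0.
  have := sqr_ge0 t; lra.
have [lt|ge] := ltP y 2^-1.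
  have lim : 1 - (2 * y) ^+ n @[n --> \oo] --> (1 : R).
    rewrite -[X in _ --> X]subr0; apply: cvgB; first exact: cvg_cst.
    by apply: cvg_expr; rewrite ger0_norm ?mulr_ge0//; lra.
  apply: (@squeeze_cvgr _ _ _ _ (fun n => 1 - (2 * y) ^+ n) (fun=> 1)) lim _; last exact: cvg_cst.
  apply: nearW => n; rewrite b1 andbT.
  by rewrite exprMn -natrX; apply: bern.
have gt : 2^-1 < y by rewrite lt_neqAle eq_sym y2.
have lim : ((2 * y)^-1) ^+ n @[n --> \oo] --> (0 : R).
  by apply: cvg_expr; rewrite ger0_norm ?invr_ge0 ?mulr_ge0// invf_lt1; lra.
apply: (@squeeze_cvgr _ _ _ _ (fun=> 0) (fun n => (2 * y)^-1 ^+ n)) _ lim; last exact: cvg_cst.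
apply: nearW => n; rewrite b0 /=.
have p0 : 0 < (2 * y) ^+ n by rewrite exprn_gt0//; lra.
rewrite exprVn -[leRHS]mul1r ler_pdivlMr//.
apply: le_trans (bern2 (y ^+ n) (2 ^ n)%N (yn n)).
by rewrite mulrC ler_wpM2r// natrX -exprMn lerDr.
Qed.

End fourier.

(** * Vanishing Fourier coefficients force a null function *)

Section fourier_uniqueness.
Variable R : realType.
Implicit Types (f g h : circle R -> R[i]) (a : R[i]).
Local Notation mu := (arc_measure R).
Local Notation lambda := (@lebesgue_measure R).
Local Notation arc := (`[(- pi)%R, pi[%classic : set R).

Lemma ae_arc_neq (x : R) : {ae mu, forall w, w != x}.
Proof.
apply: arc_ae; exists [set x]; split => //; first exact: lebesgue_measure_set1.
by move=> w /= /not_implyP[_ /negP]; rewrite negbK => /eqP.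
Qed.

Lemma sin_mul_sin (A B : R) : 2 * (sin A * sin B) = cos (A - B) - cos (A + B).
Proof. by rewrite cosB cosD; ring. Qed.

(** The bumps converge boundedly to the indicator of the arc from [-pi] to [x], and each has
    integral zero against [f]; dominated convergence concludes. The half-line may replace the arc
    because the measure lives on [[-pi, pi)]. *)
Lemma fourier_null_Rintegral f (x : R) : - pi < x < pi -> fourier_null f ->
  Rintegral mu `]-oo, x] (fun w => complex.Re (f (cis w))) = 0.
Proof.
move=> /andP[pix xpi] f0; have [fi _] := f0; have [[mR _] _] := fi.
(* On the arc, [sin ((w + pi) / 2) sin ((x - w) / 2)] is positive exactly between [-pi] and [x]. By
   the product formula it equals [(cos (w - w0) - cos h) / 2], a trigonometric polynomial of degree
   1. Scaling it into [[0, 1]] around the threshold 1/2 gives [sg]; [a] and [b] are its Fourier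
   coefficients. *)
pose w0 : R := (x - pi) / 2; pose h : R := (x + pi) / 2.
pose a : R[i] := (- cos w0 / 8%:R) +i* (sin w0 / 8%:R).
pose b : R[i] := (2^-1 + cos h / 4%:R)%:C.
pose s (z : circle R) := a * sval z ^ 1 + b + a^*%C * sval z ^ (-1).
pose sg w : R := (1 - sin ((w + pi) / 2) * sin ((x - w) / 2)) / 2.
have sE w : s (cis w) = (sg w)%:C.
  have E : 2 * (sin ((w + pi) / 2) * sin ((x - w) / 2)) = cos (w - w0) - cos h.
    by rewrite sin_mul_sin; congr (cos _ - cos _); rewrite ?/w0 ?/h; field.
  rewrite /s !cisX /sg mul1r mulN1r cosN sinN.
  apply: complex_eq => /=; last by ring.
  move: E; rewrite cosB; lra.
pose F n (z : circle R) := (1 - s z ^+ n) ^+ (2 ^ n)%N * f z.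
have F0 n : fourier_null (F n) by exact: fourier_null_bump.
have FE n w : complex.Re (F n (cis w)) = (1 - sg w ^+ n) ^+ (2 ^ n)%N * complex.Re (f (cis w)).
  rewrite /F sE -rmorphXn -[1]/(1%:C) -rmorphB -rmorphXn RecM /=.
  by rewrite mul0r subr0.
have FR n : (\int[mu]_w (complex.Re (F n (cis w)))%:E = 0)%E.
  have [Fi /(_ 0)] := F0 n; rewrite /fourier.
  under [fun z => _]eq_fun do rewrite expr0z mulr1.
  move=> /(congr1 (@complex.Re R)) /= E.
  rewrite -[LHS]fineK; first by rewrite -[fine _]/(Rintegral mu setT (fun w => complex.Re (F n
      (cis w)))) E.
  exact: (integrable_fin_num measurableT (integrable_Re Fi)).
have sg01 w : 0 <= sg w <= 1.
  have : `|sin ((w + pi) / 2) * sin ((x - w) / 2)| <= 1.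
    by rewrite normrM -[leRHS]mulr1 ler_pM// sin_max.
  by rewrite ler_norml /sg => /andP[h1 h2]; apply/andP; split; lra.
have [|||||_ _] := @dominated_convergence _ _ _ mu setT measurableT
    (fun n w => (complex.Re (F n (cis w)))%:E)
    (EFin \o ((fun w => complex.Re (f (cis w))) \_ `]-oo, x]))
    (fun w => `|complex.Re (f (cis w))|%:E).
- by move=> n; apply/measurable_EFinP; have [[[]]] := F0 n.
- apply/measurable_EFinP/(measurable_restrictT _ _).1 => //.
  exact: measurable_funTS.
(* At [w = -pi] and [w = x] one has [sg w = 1/2], where the bumps tend to neither 0 nor 1; both
   points are null. *)
- have inside : {ae mu, forall w, - pi < w < pi} by exact: ae_arc_interior.
  apply: (ae_imp2 inside (ae_arc_neq x)) => w /andP[piw wpi] wx _.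
  apply: cvg_EFin; first exact: nearW.
  rewrite /comp /=; under eq_fun do rewrite FE.
  have pA : 0 < sin ((w + pi) / 2) by apply: sin_gt0_pi; apply/andP; split; lra.
  have cv : sg w != 2^-1 -> (1 - sg w ^+ n) ^+ (2 ^ n)%N * complex.Re (f (cis w)) @[n --> \oo] -->
      ((sg w < 2^-1)%R%:R * complex.Re (f (cis w)) : R).
    by move=> /cvg_bump-/(_ (sg01 w)) cv; apply: cvgM => //; exact: cvg_cst.
  have [lt|gt] := ltP w x.
    have pB : 0 < sin ((x - w) / 2) by apply: sin_gt0_pi; apply/andP; split; lra.
    have p := mulr_gt0 pA pB.
    have sg2 : sg w < 2^-1 by rewrite /sg; lra.
    rewrite patchE mem_set; last by rewrite /= in_itv/= ltW.
    by have := cv (negbT (lt_eqF sg2)); rewrite sg2 mul1r.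
  have {}gt : x < w by rewrite lt_neqAle eq_sym wx.
  have pB : 0 < sin (- ((x - w) / 2)) by apply: sin_gt0_pi; apply/andP; split; lra.
  have p := mulr_gt0 pA pB.
  have sg2 : 2^-1 < sg w by move: p; rewrite sinN mulrN /sg; lra.
  rewrite patchE memNset; last by rewrite /= in_itv/= leNgt gt.
  by have := cv (negbT (gt_eqF sg2)); rewrite ltNge (ltW sg2) mul0r.
- exact: integrable_norm (integrable_Re fi).
- apply: nearW => w n _; rewrite abse_EFin lee_fin FE normrM ler_piMl//.
  have /andP[h1 h2] := sg01 w.
  rewrite ger0_norm ?exprn_ge0 ?subr_ge0 ?exprn_ile1// ?subr_ge0 ?exprn_ile1//.
  by rewrite gerBl exprn_ge0.
move=> lim; rewrite Rintegral_mkcond /Rintegral.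
have -> : (\int[mu]_w (((fun w => complex.Re (f (cis w))) \_ `]-oo, x]) w)%:E = 0)%E.
  move: lim; rewrite (_ : [sequence _]_n = fun=> 0%E); last by apply/funext => n; exact: FR.
  by move=> lim; apply: (cvg_unique (@ereal_hausdorff R) lim); exact: cvg_cst.
by [].
Qed.

(** The primitive of the real part, cut off outside the arc, vanishes identically on [(-pi, pi)]. By
    Lebesgue differentiation its derivative is almost everywhere the function itself. *)
Lemma fourier_null_Re f : fourier_null f -> {ae mu, forall w, complex.Re (f (cis w)) = 0}.
Proof.
move=> f0; have [fi _] := f0; have [[mR _] _] := fi.
have mRE : measurable_fun setT (EFin \o (fun w => complex.Re (f (cis w)))) by
    exact/measurable_EFinP.
have Ri := integrable_Re fi.
have marc : measurable (arc : set (measurableTypeR R)) by [].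
have li : lambda.-integrable arc (EFin \o (fun w => complex.Re (f (cis w)))).
  by have := (integrable_arc measurableT mRE).1 Ri; rewrite setTI.
pose phi := (fun w => complex.Re (f (cis w))) \_ arc.
have li' : lambda.-integrable setT (EFin \o phi).
  by have := (integrable_mkcond _ marc).1 li; rewrite restrict_EFin.
have loc : locally_integrable setT phi by exact: integrable_locally_restrict.
have ii y : lambda.-integrable `]-oo, y] (EFin \o phi).
  exact: (integrableS measurableT _ _ li').
have F0 x : - pi < x < pi -> Rintegral lambda `]-oo, x] phi = 0.
  move=> xpi; have := fourier_null_Rintegral xpi f0.
  rewrite Rintegral_arc//; last exact: (integrableS measurableT _ _ Ri).
  have k0 : (2 * pi)^-1 != 0 :> R by rewrite gt_eqF// invr_gt0 mulr_gt0// pi_gt0.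
  move=> /eqP; rewrite mulf_eq0 (negPf k0) => /eqP E.
  by rewrite -[RHS]E Rintegral_mkcondr.
have ftc := FTC1Ny ii loc.
have H : {ae mu, forall w, - pi < w < pi -> complex.Re (f (cis w)) = 0}.
  apply: arc_ae; apply: (ae_imp ftc) => w [_ dF] wa wpi.
  rewrite -[LHS](_ : phi w = _); last by rewrite /phi patchE mem_set.
  rewrite -dF derive1E (@near_eq_derive _ _ _ _ (cst 0)) ?derive_cst//.
  have wn : w \in `]- pi, pi[ by rewrite in_itv.
  by apply: filterS (near_in_itvoo wn) => t; rewrite in_itv; exact: F0.
have inside : {ae mu, forall w, - pi < w < pi} by exact: ae_arc_interior.
by apply: (ae_imp2 inside H) => w wi; exact.
Qed.

Lemma fourier_null_ae f : fourier_null f -> ae_zero f.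
Proof.
move=> f0; have Re0 := fourier_null_Re f0.
(* The imaginary part of [f] is the real part of [- 'i * f]. *)
have Im0 := fourier_null_Re (fourier_nullM (- 'i) 0 f0).
apply: (ae_imp2 Re0 Im0) => w wr; rewrite expr0z mulr1 RecM /= => wi.
by apply: complex_eq; rewrite ?wr//; move: wi; rewrite oppr0 mul0r sub0r mulN1r opprK.
Qed.

End fourier_uniqueness.

(** * Hardy spaces *)

Section hardy.
Variable R : realType.
Implicit Types (f g h x y v : circle R -> R[i]) (a : R[i]) (P Q : {poly R[i]}).
Local Notation mu := (arc_measure R).

Lemma conj_mul a (b : R[i]) : (a * b)^*%C = a^*%C * b^*%C.
Proof. exact: rmorphM. Qed.

Lemma Hardy2P f : Hardy 2%:E f <-> sqintegrable f /\ forall n : int, 1 <= n -> fourier f n = 0.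
Proof. by split=> -[/Lp2P fi f0]; split => //; exact/Lp2P. Qed.

Lemma inner_ae f g h : circle_measurable f -> circle_measurable g -> circle_measurable h ->
  {ae mu, forall w, f (cis w) = g (cis w)} -> inner f h = inner g h.
Proof.
move=> mf mg mh fg; apply: circle_integral_ae.
- exact: circle_measurableM (circle_measurable_conj mh).
- exact: circle_measurableM (circle_measurable_conj mh).
- by apply: (ae_imp fg) => w ->.
Qed.

Lemma inner_aer f g h : circle_measurable f -> circle_measurable g -> circle_measurable h ->
  {ae mu, forall w, f (cis w) = g (cis w)} -> inner h f = inner h g.
Proof.
move=> mf mg mh fg; apply: circle_integral_ae.
- exact: circle_measurableM (circle_measurable_conj mf).
- exact: circle_measurableM (circle_measurable_conj mg).
- by apply: (ae_imp fg) => w ->.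
Qed.

Lemma inner_mulr f g h : inner f (fun z => g z * h z) = inner (fun z => f z * (g z)^*%C) h.
Proof. by rewrite !innerE; congr circle_integral; apply/funext => z /=; rewrite conj_mul mulrA.
    Qed.

Lemma inner0l f : sqintegrable f -> inner (fun=> 0) f = 0.
Proof.
move=> fi; have := innerZ 0 fi fi; rewrite mul0r.
by under eq_fun do rewrite mul0r.
Qed.

Lemma inner0r f : sqintegrable f -> inner f (fun=> 0) = 0.
Proof. by move=> fi; rewrite inner_conj ?inner0l ?conjc0//; exact: sqintegrable_cst. Qed.

Lemma sqintegrable_char_mul (n : int) f : sqintegrable f -> sqintegrable (fun z => sval z ^ n * f
    z).
Proof.
move=> fi; apply: (sqintegrable_le _ fi).
  by apply: circle_measurableM; [exact: circle_measurable_char|case: fi].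
by move=> z; rewrite modulusM modulus_char mul1r.
Qed.

(** Polynomials in [z^-1]: in the exterior convention these are the analytic polynomials. *)
Definition apoly P : circle R -> R[i] := fun z => P.[(sval z)^-1].

Lemma apoly0 z : apoly 0 z = 0. Proof. exact: horner0. Qed.
Lemma apolyC a z : apoly a%:P z = a. Proof. exact: hornerC. Qed.
Lemma apoly1 z : apoly 1 z = 1. Proof. exact: hornerC. Qed.
Lemma apolyD P Q z : apoly (P + Q) z = apoly P z + apoly Q z. Proof. exact: hornerD. Qed.
Lemma apolyB P Q z : apoly (P - Q) z = apoly P z - apoly Q z.
Proof. by rewrite /apoly hornerD hornerN. Qed.
Lemma apolyM P Q z : apoly (P * Q) z = apoly P z * apoly Q z. Proof. exact: hornerM. Qed.
Lemma apolyZ a P z : apoly (a *: P) z = a * apoly P z. Proof. exact: hornerZ. Qed.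
Lemma apolyX z : apoly 'X z = sval z ^ (-1). Proof. by rewrite /apoly hornerX. Qed.
Lemma apolyXn (n : nat) z : apoly 'X^n z = sval z ^ (- n%:Z).
Proof. by rewrite /apoly hornerXn exprVn -exprnN. Qed.

Lemma sqintegrable_apoly P f : sqintegrable f -> sqintegrable (fun z => apoly P z * f z).
Proof.
elim/poly_ind: P f => [|P a IH] f fi.
  by under eq_fun do rewrite apoly0 mul0r; exact: sqintegrable_cst.
under eq_fun do rewrite apolyD apolyM apolyC apolyX mulrDl -mulrA.
apply: sqintegrableD; last exact: sqintegrableZ.
exact/IH/sqintegrable_char_mul.
Qed.

(** Peeling a factor [z^-1] off the polynomial moves it onto [f], which is why the induction
    generalizes over [f]. *)
Lemma inner_apoly0 P f h : sqintegrable f -> sqintegrable h ->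
  (forall m : nat, inner h (fun z => sval z ^ (- m%:Z) * f z) = 0) ->
  inner h (fun z => apoly P z * f z) = 0.
Proof.
elim/poly_ind: P f => [|P a IH] f fi hi h0.
  by under [fun z => _]eq_fun do rewrite apoly0 mul0r; rewrite inner0r.
under [fun z => _]eq_fun do rewrite apolyD apolyM apolyC apolyX mulrDl -mulrA.
have zfi := sqintegrable_char_mul (-1) fi.
rewrite innerDr//; last 2 first.
- exact: sqintegrable_apoly.
- exact: sqintegrableZ.
rewrite IH//; last first.
  move=> m; rewrite -[RHS](h0 m.+1); congr inner; apply/funext => z.
  by rewrite mulrA -expfzDr ?sval_neq0//; congr (_ ^ _ * _); rewrite -[in RHS]addn1 PoszD opprD.
rewrite add0r innerZr// (_ : inner h f = 0) ?mulr0// -[RHS](h0 0%N).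
by congr inner; apply/funext => z; rewrite oppr0 expr0z mul1r.
Qed.

Lemma apoly_mul1 P : (fun z => apoly P z * 1) = apoly P.
Proof. by apply/funext => z; rewrite mulr1. Qed.

Lemma sqintegrable_apoly1 P : sqintegrable (apoly P).
Proof.
by rewrite -apoly_mul1; apply: sqintegrable_apoly; exact: sqintegrable_cst.
Qed.

Lemma inner_apoly1 P h : sqintegrable h ->
  (forall m : nat, inner h (fun z => sval z ^ (- m%:Z)) = 0) -> inner h (apoly P) = 0.
Proof.
move=> hi h0; rewrite -apoly_mul1; apply: inner_apoly0 => //; first exact: sqintegrable_cst.
by move=> m; rewrite -[RHS](h0 m); congr (inner h _); apply/funext => z; rewrite mulr1.
Qed.

Lemma inner_char (m n : int) :
  inner (fun z : circle R => sval z ^ m) (fun z => sval z ^ n) = (m == n)%:R.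
Proof.
rewrite -fourierE /fourier.
under [fun z => _]eq_fun do rewrite -expfzDr ?sval_neq0//.
by rewrite circle_integral_char subr_eq0.
Qed.

Lemma fourier_apoly P (n : int) : 1 <= n -> fourier (apoly P) n = 0.
Proof.
move=> n1; rewrite fourierE inner_conj; last 2 first.
- exact: sqintegrable_char.
- exact: sqintegrable_apoly1.
rewrite inner_apoly1 ?conjc0//; first exact: sqintegrable_char.
by move=> m; rewrite inner_char; case: eqP n1 => // ->; lia.
Qed.

(* By density of the analytic polynomials in H_2. *)
Lemma Hardy2_orthogonal g x : sqintegrable g ->
  (forall m : nat, inner g (fun z => sval z ^ (- m%:Z)) = 0) ->
  Hardy 2%:E x -> inner g x = 0.
Proof.
move=> gi g0 /Hardy2P[xi x0].
pose S : set (circle R -> R[i]) := range apoly.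
have Si s : S s -> sqintegrable s by move=> [P _ <-]; exact: sqintegrable_apoly1.
have [||a s t [P _ <-] [Q _ <-]|h [hS hort]] := @orthogonal_projection R S x xi.
- by exists 0 => //; apply/funext => z; rewrite apoly0.
- exact: Si.
- by exists (a *: P + Q) => //; apply/funext => z; rewrite apolyD apolyZ.
have hi := hS.1.
have xhi := sqintegrableB xi hi.
(* For [n >= 1] the coefficients of [x] and of [h] both vanish; for [n <= 0] the character [z^n] is
   itself a polynomial in [z^-1], to which the residual is orthogonal. *)
have : fourier_null (fun z => x z - h z).
  split; first exact: sqintegrable_cintegrable.
  move=> n; have [n1|] := leP 1 n.
    rewrite fourierE innerB//; last exact: sqintegrable_char.
    rewrite -fourierE x0// sub0r (_ : inner h _ = 0) ?oppr0//.
    apply: (inner_L2closure _ (sqintegrable_char R n) hS) => s Ss; split; first exact: Si.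
    by case: Ss => P _ <-; rewrite -fourierE fourier_apoly.
  rewrite fourierE => n1; apply: hort; exists 'X^`|n|%N => //; apply/funext => z.
  by rewrite apolyXn; congr (_ ^ _); lia.
move=> /fourier_null_ae xh.
have -> : inner g x = inner g h.
  apply: inner_aer; [exact: xi.1|exact: hi.1|exact: gi.1|].
  by apply: (ae_imp xh) => w /eqP; rewrite subr_eq0 => /eqP.
rewrite inner_conj// (_ : inner h g = 0) ?conjc0//.
apply: (inner_L2closure _ gi hS) => s Ss; split; first exact: Si.
case: Ss => P _ <-; rewrite inner_conj//; last exact: sqintegrable_apoly1.
by rewrite inner_apoly1 ?conjc0.
Qed.

Definition ae_bounded f := circle_measurable f /\
  exists M : R, {ae mu, forall w, modulus (f (cis w)) <= M}.

Lemma ae_bounded_sq f : ae_bounded f -> sqintegrable f.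
Proof. by move=> [mf [M fM]]; exact: (sqintegrable_bounded mf fM). Qed.

Lemma ae_bounded_mul f g : ae_bounded f -> sqintegrable g -> sqintegrable (fun z => f z * g z).
Proof. by move=> [mf [M fM]] gi; have [] := sqintegrable_bounded_mul mf fM gi. Qed.

Lemma ae_bounded_mulr f g : ae_bounded f -> sqintegrable g -> sqintegrable (fun z => g z * f z).
Proof. by move=> fb gi; under eq_fun do rewrite mulrC; exact: ae_bounded_mul. Qed.

Lemma ae_bounded_conj f : ae_bounded f -> ae_bounded (fun z => (f z)^*%C).
Proof.
move=> [mf [M fM]]; split; first exact: circle_measurable_conj.
by exists M; apply: (ae_imp fM) => w; rewrite modulus_conj.
Qed.

(** The product [x y] is only integrable, so density is used on one factor at a time: first [y] is
    replaced by [z^-m], which leaves [inner (z^m f) x], and then [x] by [z^-k], which leaves the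
    coefficient of [f] at [-(m + k)]. *)
Lemma inner_Hardy2_mul f x y : ae_bounded f ->
  (forall m : nat, inner f (fun z => sval z ^ (- m%:Z)) = 0) ->
  Hardy 2%:E x -> Hardy 2%:E y -> inner f (fun z => x z * y z) = 0.
Proof.
move=> fb f0 Hx Hy; have [xi _] := (Hardy2P x).1 Hx.
have fi := ae_bounded_sq fb.
rewrite inner_mulr; apply: Hardy2_orthogonal => //.
  by apply: ae_bounded_mul => //; exact: sqintegrable_conj.
move=> m.
have -> : inner (fun z => f z * (x z)^*%C) (fun z => sval z ^ (- m%:Z)) =
    inner (fun z => sval z ^ m * f z) x.
  rewrite !innerE; congr circle_integral; apply/funext => z /=.
  by rewrite conj_char opprK; ring.
apply: Hardy2_orthogonal => //; first exact: sqintegrable_char_mul.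
move=> k; rewrite -[RHS](f0 (m + k)%N) !innerE; congr circle_integral; apply/funext => z.
by rewrite !conj_char !opprK PoszD expfzDr ?sval_neq0//; ring.
Qed.

(** Moving [p] to the other side leaves [z^n conj(p)] against [k]. By density [k] may be replaced by
    [z^-m], and then a coefficient of [p] at [n + m >= 1] remains. *)
Lemma Hardy2_mul_bounded p k : ae_bounded p -> Hardy 2%:E p -> Hardy 2%:E k ->
  Hardy 2%:E (fun z => p z * k z).
Proof.
move=> pb /Hardy2P[pi0 p0] Hk; have [ki k0] := (Hardy2P k).1 Hk.
apply/Hardy2P; split; first exact: ae_bounded_mul.
move=> n n1; rewrite fourierE inner_conj; last 2 first.
- exact: sqintegrable_char.
- exact: ae_bounded_mul.
rewrite inner_mulr Hardy2_orthogonal ?conjc0//.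
  by apply: ae_bounded_mulr; [exact: ae_bounded_conj|exact: sqintegrable_char].
move=> m; have -> : inner (fun z => sval z ^ n * (p z)^*%C) (fun z => sval z ^ (- m%:Z)) =
    inner (fun z => sval z ^ (n + m)) p.
  rewrite !innerE; congr circle_integral; apply/funext => z /=.
  by rewrite conj_char opprK expfzDr ?sval_neq0//; ring.
rewrite inner_conj//; last exact: sqintegrable_char.
by rewrite -fourierE p0 ?conjc0//; lia.
Qed.

(* The residual [phi] of the projection of [v] onto the closed span of the [z^-k v], [k >= 1],
   is orthogonal to all [z^-k phi], so [|phi|^2] has no nonconstant Fourier component. *)
Lemma szego_projection v : sqintegrable v -> exists phi (c : R),
  [/\ L2closure [set s | exists Q, s = fun z => apoly (1 - 'X * Q) z * v z] phi,
      forall k : nat, inner phi (fun z => sval z ^ (- k.+1%:Z) * v z) = 0 &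
      {ae mu, forall w, modulus (phi (cis w)) ^+ 2 = c}].
Proof.
move=> vi; pose S := [set s | exists Q, s = fun z : circle R => apoly ('X * Q) z * v z].
have Si s : S s -> sqintegrable s by move=> [Q ->]; exact: sqintegrable_apoly.
have [||a s t [P ->] [Q ->]|h [hS hort]] := @orthogonal_projection R S v vi.
- by exists 0; apply/funext => z; rewrite mulr0 apoly0 mul0r.
- exact: Si.
- exists (a *: P + Q); apply/funext => z.
  by rewrite mulrDr -scalerAr apolyD apolyZ; ring.
have hi := hS.1; pose phi z := v z - h z.
have phii : sqintegrable phi by exact: sqintegrableB.
pose S1 := [set s | exists Q, s = fun z : circle R => apoly (1 - 'X * Q) z * v z].
have S1i s : S1 s -> sqintegrable s by move=> [Q ->]; exact: sqintegrable_apoly.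
have phiS1 : L2closure S1 phi.
  split => // e /(hS.2)[s [[Q ->] lt]]; exists (fun z => apoly (1 - 'X * Q) z * v z).
  split; first by exists Q.
  rewrite sqnormBC; rewrite (_ : (fun z => _ - _) = (fun z => apoly ('X * Q) z * v z - h z))//.
  by apply/funext => z; rewrite /phi apolyB apoly1; ring.
pose c := sqnorm phi.
(* Replace the left-hand [phi] by an approximant [(1 - z^-1 Q) v] and move the character across: the
   product [z^-(k+1) (1 - z^-1 Q) v] lies in [S], hence is orthogonal to [phi]. *)
have phi0 (k : nat) : inner phi (fun z => sval z ^ (k.+1%:Z) * phi z) = 0.
  have gi := sqintegrable_char_mul k.+1%:Z phii.
  apply: (inner_L2closure _ gi phiS1) => s Ss; split; first exact: S1i.
  rewrite inner_mulr inner_conj//; last first.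
    under eq_fun do rewrite conj_char mulrC.
    exact/sqintegrable_char_mul/S1i.
  case: Ss => Q ->; rewrite (_ : inner _ _ = 0) ?conjc0//.
  apply: hort; exists ('X^k * (1 - 'X * Q)); apply/funext => z.
  rewrite conj_char mulrA -exprS apolyM apolyXn; ring.
have sq_int : cintegrable (fun z => (modulus (phi z) ^+ 2)%:C).
  by apply: cintegrable_real; case: phii.
(* [phi0] handles one sign of the frequency; the other follows by conjugation because [|phi|^2] is
   real. *)
have fourier_sq (n : int) : n != 0 -> fourier (fun z => (modulus (phi z) ^+ 2)%:C) n = 0.
  have neg (k : nat) : circle_integral (fun z => (modulus (phi z) ^+ 2)%:C * sval z ^ (-
      k.+1%:Z)) = 0.
    rewrite -[RHS](phi0 k) innerE; congr circle_integral; apply/funext => z.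
    by rewrite conj_mul conj_char -mul_conj; ring.
  case: n => [[//|k] _|k _]; first exact: neg.
  rewrite /fourier NegzE opprK -[RHS]conjc0 -(neg k) -circle_integral_conj; last first.
    exact: cintegrable_char_mul.
  congr circle_integral; apply/funext => z.
  by rewrite conj_mul conjc_real conj_char opprK.
exists phi, c; split => //.
  move=> k; apply: hort; exists 'X^k; apply/funext => z.
  by rewrite -exprS apolyXn.
have : fourier_null (fun z => (modulus (phi z) ^+ 2)%:C + (- c)%:C * sval z ^ 0).
  split; first by apply: cintegrableD => //;
      apply/cintegrableZ/sqintegrable_cintegrable/sqintegrable_char.
  move=> n; rewrite /fourier.
  under [fun z => _]eq_fun do rewrite mulrDl -mulrA -expfzDr ?sval_neq0// add0r.
  rewrite circle_integralD; last 2 first.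
  - exact: cintegrable_char_mul.
  - exact/cintegrableZ/sqintegrable_cintegrable/sqintegrable_char.
  rewrite circle_integralZ; last exact/sqintegrable_cintegrable/sqintegrable_char.
  rewrite circle_integral_char oppr_eq0; have [->|n0] := eqVneq n 0.
    under [fun z => _]eq_fun do rewrite oppr0 expr0z mulr1.
    by rewrite circle_integral_real mulr1 rmorphN subrr.
  by rewrite mulr0 addr0; exact: fourier_sq.
move=> /fourier_null_ae h0; apply: (ae_imp h0) => w.
rewrite expr0z mulr1 => /(congr1 (@complex.Re R)) /= /eqP.
by rewrite subr_eq0 => /eqP.
Qed.

(* The Szego projection [phi] of [y] vanishes wherever [y] does, while [|phi|] is a nonzero
   constant. *)
Lemma Hardy2_ae_neq0 y : Hardy 2%:E y -> ~ ae_zero y -> {ae mu, forall w, y (cis w) != 0}.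
Proof.
move=> /Hardy2P[yi y0] ynz.
have [phi [c [phiS phiort phic]]] := szego_projection yi.
have phii := phiS.1.
have ex_n : exists n : nat, fourier y (- n%:Z) != 0.
  apply: contrapT => /forallNP all0; apply: ynz; apply: fourier_null_ae.
  split; first exact: sqintegrable_cintegrable.
  move=> n; have [/y0//|n0] := leP 1 n.
  have /negP := all0 `|n|%N; rewrite negbK => /eqP.
  by rewrite (_ : - _ = n)//; lia.
(* [n] is the order of vanishing of [y] at infinity. The terms [z^-1 Q y] start at [z^-(n+1)], so
   [phi] inherits the leading coefficient of [y] and cannot be null. *)
case: (ex_minnP ex_n) => n yn nmin.
have phin : inner phi (fun z => sval z ^ (- n%:Z)) = fourier y (- n%:Z).
  apply: (inner_L2closure _ (sqintegrable_char R _) phiS) => _ [Q ->]; split.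
    exact: sqintegrable_apoly.
  rewrite inner_conj; last 2 first.
  - exact: sqintegrable_char.
  - exact: sqintegrable_apoly.
  have -> : (fun z => apoly (1 - 'X * Q) z * y z) =
      (fun z => y z + (-1) * (apoly Q z * (sval z ^ (-1) * y z))).
    by apply/funext => z; rewrite apolyB apolyM apolyX apoly1; ring.
  have zyi := sqintegrable_char_mul (-1) yi.
  have chi := sqintegrable_char R (- n%:Z).
  rewrite innerDr//; last exact/sqintegrableZ/sqintegrable_apoly.
  rewrite innerZr//; last exact: sqintegrable_apoly.
  rewrite inner_apoly0//; first by rewrite mulr0 addr0 -inner_conj// fourierE.
  move=> m; rewrite inner_conj//; last exact: sqintegrable_char_mul.
  have -> : inner (fun z => sval z ^ (- m%:Z) * (sval z ^ (-1) * y z)) (fun z => sval z ^ (-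
      n%:Z)) =
      fourier y (m.+1%:Z - n%:Z).
    rewrite innerE; congr circle_integral; apply/funext => z.
    rewrite conj_char mulrA -expfzDr ?sval_neq0// mulrAC -expfzDr ?sval_neq0// mulrC.
    by congr (_ * _ ^ _); lia.
  have [/y0->|mn] := leP 1 (m.+1%:Z - n%:Z); first by rewrite conjc0.
  have mn' : (m < n)%N by lia.
  apply/eqP; rewrite conjc_eq0; apply: contraTT mn' => /= h.
  have := nmin (n - m.+1)%N; rewrite (_ : - _ = m.+1%:Z - n%:Z :> int); last by lia.
  by move=> /(_ h); lia.
have c0 : c != 0.
  apply: contraNneq yn => c0; rewrite -phin.
  have : {ae mu, forall w, phi (cis w) = 0}.
    by apply: (ae_imp phic) => w; rewrite c0 => /eqP; rewrite sqrf_eq0 modulus_eq0 => /eqP.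
  move=> h; rewrite (@inner_ae phi (fun=> 0)).
  - by rewrite inner0l//; exact: sqintegrable_char.
  - exact: phii.1.
  - exact: circle_measurable_cst.
  - exact: circle_measurable_char.
  - exact: h.
(* [chi] is the indicator of the zero set of [y]. It kills every multiple of [y], hence also the L_2
   limit [phi]. *)
pose chi z : R[i] := (if modulus (y z) == 0 then 1 else 0 : R)%:C.
have mchi : circle_measurable chi.
  apply: circle_measurable_real; apply: measurable_fun_ifT => //.
  by apply: measurable_fun_eqr => //; exact: measurable_modulus yi.1.
have chi1 z : modulus (chi z) <= 1.
  by rewrite modulusR; case: ifP => _; rewrite ?normr1 ?normr0.
have sqchi f : sqintegrable f -> sqintegrable (fun z => chi z * f z) /\ sqnorm (fun z => chi z *
    f z) <= sqnorm f.
  move=> fi; have := @sqintegrable_bounded_mul R chi f 1 mchi _ fi.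
  by rewrite expr1n mul1r; apply; apply: nearW => w; exact: chi1.
have chiphi0 : sqnorm (fun z => chi z * phi z) = 0.
  apply/eqP; rewrite eq_le sqnorm_ge0 andbT; apply/ler_addgt0Pl => e e0; rewrite addr0.
  have [_ [[Q ->] lt]] := phiS.2 e e0.
  have si : sqintegrable (fun z => apoly (1 - 'X * Q) z * y z) by exact: sqintegrable_apoly.
  have [_ le] := sqchi _ (sqintegrableB phii si).
  apply: ltW; apply: le_lt_trans lt; rewrite sqnormBC; apply: le_trans le.
  rewrite le_eqVlt; apply/orP; left; apply/eqP.
  congr sqnorm; apply/funext => z; rewrite mulrBr /chi; case: ifP => [|_].
    by rewrite modulus_eq0 => /eqP ->; rewrite mulr0 mulr0 subr0.
  by rewrite !mul0r subr0.
have := sqnorm_eq0 (sqchi _ phii).1 chiphi0.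
move=> h; apply: (ae_imp2 h phic) => w; rewrite /chi; case: ifP => [|/negbT].
  move=> _; rewrite mul1r => -> /esym/eqP; rewrite (_ : modulus 0 = 0).
    by rewrite expr0n (negbTE c0).
  by apply/eqP; rewrite modulus_eq0.
by rewrite modulus_eq0.
Qed.

End hardy.

(** * Approximate factorization of H_2 functions *)

Section factorization.
Variable R : realType.
Implicit Types (f g h k x y v : circle R -> R[i]) (a : R[i]).
Local Notation mu := (arc_measure R).

Definition L1norm f : R := Rintegral mu setT (fun w => modulus (f (cis w))).

Lemma Hardy2Z a f : Hardy 2%:E f -> Hardy 2%:E (fun z => a * f z).
Proof.
move=> /Hardy2P[fi f0]; apply/Hardy2P; split; first exact: sqintegrableZ.
move=> n n1; rewrite fourierE innerZ//; last exact: sqintegrable_char.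
by rewrite -fourierE f0// mulr0.
Qed.

Lemma Hardy2D f g : Hardy 2%:E f -> Hardy 2%:E g -> Hardy 2%:E (fun z => f z + g z).
Proof.
move=> /Hardy2P[fi f0] /Hardy2P[gi g0]; apply/Hardy2P; split; first exact: sqintegrableD.
move=> n n1; rewrite fourierE innerD//; last exact: sqintegrable_char.
by rewrite -!fourierE f0// g0// addr0.
Qed.

Lemma Hardy2_0 : Hardy 2%:E (fun _ : circle R => 0).
Proof.
apply/Hardy2P; split; first exact: sqintegrable_cst.
by move=> n _; rewrite fourierE inner0l//; exact: sqintegrable_char.
Qed.

Lemma Hardy2_closed h : L2closure (Hardy 2%:E) h -> Hardy 2%:E h.
Proof.
move=> hS; apply/Hardy2P; split; first exact: hS.1.
move=> n n1; rewrite fourierE; apply: (inner_L2closure _ (sqintegrable_char R n) hS).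
by move=> s /Hardy2P[si s0]; rewrite -fourierE s0.
Qed.

(* With [u = sqrt (|k| + e)], the Szego projection [phi] of [u] has constant modulus, so
   [p = phi / u] and [1 / p] are both analytic: this replaces the inner-outer factorization. *)
Lemma Hardy2_factor k (e : R) : 0 < e -> Hardy 2%:E k -> exists q x,
  [/\ Hardy 2%:E q, Hardy 2%:E x, sqnorm q = 1, sqnorm x <= (L1norm k + e) * L1norm k &
      {ae mu, forall w, k (cis w) = q (cis w) * x (cis w)}].
Proof.
move=> e0 Hk; have [ki _] := (Hardy2P k).1 Hk; have mk := ki.1.
pose K := L1norm k.
have k1 : mu.-integrable setT (fun w => (modulus (k (cis w)))%:E).
  by have [] := sqintegrable_cintegrable ki.
have K0 : 0 <= K by apply: Rintegral_ge0 => w _; exact: modulus_ge0.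
pose r z : R := modulus (k z) + e.
have r0 z : 0 < r z by rewrite ltr_wpDl// modulus_ge0.
have mr : measurable_fun [set: R] (fun w => r (cis w)).
  by apply: measurable_funD => //; exact: measurable_modulus.
have ei : mu.-integrable setT (EFin \o (fun _ : R => e)).
  exact: (integrable_Re (sqintegrable_cintegrable (sqintegrable_cst e%:C))).
have ri : mu.-integrable setT (EFin \o (fun w => r (cis w))).
  exact: (integrableD measurableT k1 ei).
have intr : Rintegral mu setT (fun w => r (cis w)) = K + e.
  rewrite RintegralD//.
  by rewrite Rintegral_cst// arc_measureT mulr1.
pose U z : R[i] := (Num.sqrt (r z))%:C.
have modU z : modulus (U z) = Num.sqrt (r z) by rewrite modulusR ger0_norm ?sqrtr_ge0.
have sqU z : modulus (U z) ^+ 2 = r z by rewrite modU sqr_sqrtr// ltW.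
have U0 z : U z != 0 by rewrite -modulus_eq0 modU gt_eqF// sqrtr_gt0.
have mU : circle_measurable U.
  apply: circle_measurable_real.
  under eq_fun do rewrite -powR12_sqrt ?ltW//.
  exact: (measurableT_comp (measurable_powR 2^-1) mr).
have Ui : sqintegrable U by split => //; under eq_fun do rewrite sqU.
have sqnU : sqnorm U = K + e by rewrite -intr; apply: eq_Rintegral => w _; rewrite sqU.
have [phi [c [phiS phiort phic]]] := szego_projection Ui.
have phii := phiS.1.
pose V z := (U z)^-1.
have mV : circle_measurable V by exact: circle_measurableV.
have VM z : modulus (V z) <= (Num.sqrt e)^-1.
  by rewrite modulusV modU lef_pV2 ?posrE ?sqrtr_gt0// ler_wsqrtr// lerDr modulus_ge0.
have Vmul f : sqintegrable f -> sqintegrable (fun z => V z * f z) /\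
    e * sqnorm (fun z => V z * f z) <= sqnorm f.
  move=> fi; have VMae : {ae mu, forall w, modulus (V (cis w)) <= (Num.sqrt e)^-1}.
    by apply: nearW => w; exact: VM.
  have [Vfi] := sqintegrable_bounded_mul mV VMae fi.
  rewrite exprVn (sqr_sqrtr (ltW e0)) => le; split => //.
  by rewrite mulrC -ler_pdivlMr// mulrC.
(* Since [1 / U] is bounded, dividing the approximants [(1 - z^-1 Q) U] of [phi] by [U] still gives
   L_2 approximation; so [p] is a limit of the polynomials [1 - z^-1 Q] and is analytic. *)
pose p z := V z * phi z.
have [p_i _] := Vmul _ phii.
pose S1 := [set s | exists Q, s = fun z : circle R => apoly (1 - 'X * Q) z].
have pS1 : L2closure S1 p.
  split => // e' e'0; have [_ [[Q ->] lt]] := phiS.2 _ (mulr_gt0 e0 e'0).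
  exists (fun z => apoly (1 - 'X * Q) z); split; first by exists Q.
  have si : sqintegrable (fun z => apoly (1 - 'X * Q) z * U z) by exact: sqintegrable_apoly.
  have [_ le] := Vmul _ (sqintegrableB si phii).
  rewrite -(ltr_pM2l e0); apply: le_lt_trans lt; apply: le_trans le.
  rewrite le_eqVlt; apply/orP; left; apply/eqP; congr (_ * sqnorm _).
  by apply/funext => z; rewrite /p /V mulrBr mulrCA mulVf// mulr1.
have Hp : Hardy 2%:E p.
  apply/Hardy2P; split => // n n1; rewrite fourierE.
  apply: (inner_L2closure _ (sqintegrable_char R n) pS1) => _ [Q ->].
  by split; [exact: sqintegrable_apoly1|rewrite -fourierE fourier_apoly].
(* All polynomials [1 - z^-1 Q] have mean 1, so [p] does too; this excludes [phi = 0] and yields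
   [c > 0]. *)
have p1 : inner p (fun=> 1) = 1.
  apply: (inner_L2closure _ (sqintegrable_cst (1 : R[i])) pS1) => _ [Q ->]; split.
    exact: sqintegrable_apoly1.
  rewrite inner_conj; last 2 first.
  - exact: sqintegrable_cst.
  - exact: sqintegrable_apoly1.
  have -> : (fun z => apoly (1 - 'X * Q) z) = (fun z => 1 + (-1) * (apoly Q z * sval z ^ (-1))).
    by apply/funext => z; rewrite apolyB apolyM apolyX apoly1; ring.
  have i1 := sqintegrable_cst (1 : R[i]).
  have chi := sqintegrable_char R (-1).
  have one1 : inner (fun _ : circle R => 1) (fun=> 1) = 1.
    have := @inner_char R 0 0; rewrite eqxx => E; rewrite -[RHS]E.
    by congr inner; apply/funext => z; rewrite expr0z.
  rewrite innerDr//; last exact/sqintegrableZ/sqintegrable_apoly.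
  rewrite innerZr//; last exact: sqintegrable_apoly.
  rewrite one1 inner_apoly0 ?mulr0 ?addr0 ?conjc1//.
  move=> m; have -> : (fun z : circle R => sval z ^ (- m%:Z) * sval z ^ (-1)) = (fun z => sval z
      ^ (- m.+1%:Z)).
    by apply/funext => z; rewrite -expfzDr ?sval_neq0//; congr (_ ^ _); lia.
  have -> : (fun _ : circle R => 1 : R[i]) = (fun z => sval z ^ 0) by apply/funext => z; rewrite
      expr0z.
  by rewrite inner_char.
(* An almost everywhere identity yields an actual point because the total mass is 1. *)
have c_ge0 : 0 <= c.
  have [w <-] : exists w : R, modulus (phi (cis w)) ^+ 2 = c.
    apply: contrapT => /forallNP noc.
    have : {ae mu, forall w : R, False} by apply: (ae_imp phic) => w /noc.
    move=> [N [mN N0 subN]]; have NT : N = setT.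
      by apply/seteqP; split => // w _; apply: subN => /=; case.
    by move: N0; rewrite NT arc_measureT => /eqP; rewrite onee_eq0.
  exact: sqr_ge0.
have c0 : 0 < c.
  rewrite lt_neqAle c_ge0 andbT eq_sym; apply/eqP => c0.
  have : inner p (fun=> 1) = inner (fun=> 0) (fun=> 1).
    apply: inner_ae; [exact: p_i.1|exact: circle_measurable_cst|exact: circle_measurable_cst|].
    apply: (ae_imp phic) => w; rewrite c0 => /eqP; rewrite sqrf_eq0 modulus_eq0 => /eqP phi0.
    by rewrite /p phi0 mulr0.
  rewrite p1 inner0l//; last exact: sqintegrable_cst.
  by move=> /eqP; rewrite oner_eq0.
have phiE : {ae mu, forall w, modulus (phi (cis w)) = Num.sqrt c}.
  by apply: (ae_imp phic) => w <-; rewrite sqrtr_sqr ger0_norm// modulus_ge0.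
have pb : ae_bounded p.
  split; first exact: p_i.1.
  exists ((Num.sqrt e)^-1 * Num.sqrt c); apply: (ae_imp phiE) => w h.
  by rewrite modulusM h ler_wpM2r ?sqrtr_ge0.
(* Since [|phi|^2 = c], this is [c / p] almost everywhere. Its coefficients at [n >= 1] are the
   conjugates of the inner products of [phi] with [z^-n U], which vanish by the choice of [phi]. *)
pose q z := (phi z)^*%C * U z.
have phicb : ae_bounded (fun z => (phi z)^*%C).
  apply: ae_bounded_conj; split; first exact: phii.1.
  by exists (Num.sqrt c); apply: (ae_imp phiE) => w ->.
have qi : sqintegrable q by exact: ae_bounded_mul.
have Hq : Hardy 2%:E q.
  apply/Hardy2P; split => // n n1; rewrite /fourier.
  have [m nE] : exists m : nat, n = m.+1%:Z by exists `|n|.-1%N; lia.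
  rewrite -[RHS]conjc0 -(phiort m) inner_conj; last 2 first.
  - exact: sqintegrable_char_mul.
  - exact: phii.
  rewrite conjcK innerE; congr circle_integral; apply/funext => z.
  by rewrite /q nE; ring.
pose x z := p z * k z.
have Hx : Hardy 2%:E x by exact: Hardy2_mul_bounded.
have sqq : sqnorm q = c * (K + e).
  rewrite -sqnU -[c](sqr_sqrtr c_ge0) -[Num.sqrt c]ger0_norm ?sqrtr_ge0// -modulusR -sqnormZ//.
  apply: sqnorm_ae; first exact: qi.1.
    by apply: circle_measurableM => //; exact: circle_measurable_cst.
  apply: (ae_imp phiE) => w h.
  by rewrite !modulusM modulus_conj h modulusR ger0_norm// sqrtr_ge0.
have [Vki _] := Vmul _ ki.
(* [|x|^2 = c |k|^2 / (|k| + e)], which is at most [c |k|]. *)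
have sqx : sqnorm x <= c * K.
  have -> : sqnorm x = c * sqnorm (fun z => V z * k z).
    rewrite -[c](sqr_sqrtr c_ge0) -[Num.sqrt c]ger0_norm ?sqrtr_ge0// -modulusR -sqnormZ//.
    apply: sqnorm_ae; first by have [/Lp2P[]] := Hx.
      by apply: circle_measurableM; [exact: circle_measurable_cst|exact: Vki.1].
    apply: (ae_imp phiE) => w h.
    by rewrite !modulusM h modulusR ger0_norm ?sqrtr_ge0// mulrA [_ * Num.sqrt c]mulrC -mulrA.
  rewrite ler_pM2l//; apply: le_Rintegral => //; first exact: Vki.2.
  move=> w _; rewrite modulusM exprMn modulusV exprVn sqU mulrC ler_pdivrMr//.
  by rewrite expr2 ler_wpM2l ?modulus_ge0// lerDl ltW.
have Ke : 0 < K + e by rewrite ltr_wpDl.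
(* One has [q x = c k] almost everywhere. Dividing [q] by its norm [t] and multiplying [x] by
   [t / c] restores [k]. *)
pose t := Num.sqrt (c * (K + e)).
have t0 : 0 < t by rewrite sqrtr_gt0 mulr_gt0.
have t2 : t ^+ 2 = c * (K + e) by rewrite sqr_sqrtr// mulr_ge0 ?ltW.
exists (fun z => (t^-1)%:C * q z), (fun z => (t / c)%:C * x z); split.
- exact: Hardy2Z.
- exact: Hardy2Z.
- rewrite sqnormZ// modulusR real_normK ?num_real// exprVn t2 sqq mulVf// mulf_neq0 ?gt_eqF//.
- rewrite sqnormZ; last by have [/Lp2P] := Hx.
  rewrite modulusR real_normK ?num_real// exprMn exprVn t2.
  apply: le_trans (ler_wpM2l _ sqx) _; first by rewrite divr_ge0 ?sqr_ge0// mulr_ge0 ?ltW.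
  rewrite le_eqVlt; apply/orP; left; apply/eqP; rewrite -/K.
  by field; rewrite gt_eqF.
- apply: (ae_imp phic) => w h.
  have -> : (t^-1)%:C * q (cis w) * ((t / c)%:C * x (cis w)) =
      (t^-1 * (t / c))%:C * (phi (cis w) * (phi (cis w))^*%C) * (V (cis w) * U (cis w)) * k (cis
          w).
    by rewrite rmorphM /q /x /p; ring.
  rewrite mul_conj h /V mulVf// mulr1 -rmorphM.
  rewrite (_ : t^-1 * (t / c) * c = 1) ?rmorph1 ?mul1r//.
  by rewrite mulrA mulVf ?gt_eqF// mul1r mulVf// gt_eqF.
Qed.

End factorization.

(** * Hankel operators *)

Section hankel.
Variable R : realType.
Implicit Types (f g h k x y v : circle R -> R[i]) (a : R[i]).
Local Notation mu := (arc_measure R).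

Lemma circle_conjK (z : circle R) : circle_conj (circle_conj z) = z.
Proof. by apply: val_inj => /=; exact: conjcK. Qed.

Lemma sval_circle_conj (z : circle R) : sval (circle_conj z) = (sval z)^-1.
Proof. by rewrite -conj_sval. Qed.

Definition sharp y : circle R -> R[i] := fun z => (y (circle_conj z))^*%C.

Lemma sqintegrable_reversion y : sqintegrable y -> sqintegrable (reversion y).
Proof. exact: sqintegrable_comp_conj. Qed.

Lemma sqnorm_reversion y : sqintegrable y -> sqnorm (reversion y) = sqnorm y.
Proof. by move=> [my _]; exact: sqnorm_comp_conj. Qed.

Lemma sqnorm_sharp y : sqintegrable y -> sqnorm (sharp y) = sqnorm y.
Proof.
move=> yi; rewrite -(sqnorm_reversion yi).
by apply: eq_Rintegral => w _; rewrite modulus_conj.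
Qed.

Lemma reversion_sharp y : reversion (sharp y) = fun z => (y z)^*%C.
Proof. by apply/funext => z; rewrite /reversion /sharp circle_conjK. Qed.

Lemma Hardy2_sharp y : Hardy 2%:E y -> Hardy 2%:E (sharp y).
Proof.
move=> /Hardy2P[yi y0]; apply/Hardy2P; split.
  by apply: sqintegrable_conj; exact: sqintegrable_reversion.
move=> n n1; rewrite -[RHS]conjc0 -(y0 n n1) /fourier.
have ci := cintegrable_char_mul (- n) (sqintegrable_cintegrable yi).
rewrite -(circle_integral_comp_conj ci) -circle_integral_conj; last exact: (cintegrable_comp_conj
    ci).
congr circle_integral; apply/funext => z.
by rewrite /sharp conj_mul conj_char sval_circle_conj exprz_inv !opprK.
Qed.

Lemma Hardy2_projection f : sqintegrable f -> exists h, Hardy 2%:E h /\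
  forall k, Hardy 2%:E k -> inner (fun z => f z - h z) k = 0.
Proof.
move=> fi; have [||a s t Hs Ht|h [hS hort]] := @orthogonal_projection R (Hardy 2%:E) f fi.
- exact: Hardy2_0.
- by move=> s /Hardy2P[].
- by apply: Hardy2D => //; exact: Hardy2Z.
- by exists h; split => //; exact: Hardy2_closed.
Qed.

(** [xget] falls back to 0 on an empty set, so the existence of a projection is what gives
    [orth_proj] its meaning. *)
Lemma orth_projP f : sqintegrable f -> Hardy 2%:E (orth_proj (Hardy 2%:E) f) /\
  forall k, Hardy 2%:E k -> inner (fun z => f z - orth_proj (Hardy 2%:E) f z) k = 0.
Proof.
move=> /Hardy2_projection[h hP]; rewrite /orth_proj.
exact: (@xgetPex _ (fun=> 0) [set h | Hardy 2%:E h /\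
  forall k, Hardy 2%:E k -> inner (fun z => f z - h z) k = 0] (ex_intro _ h hP)).
Qed.

Lemma Lp_norm_yE f : Lp_norm +oo%E f = ess_sup mu (fun w => (modulus (f (cis w)))%:E).
Proof.
rewrite /Lp_norm unlock arc_measureT lte01; congr (ess_sup _ _).
by apply/funext => w /=; rewrite ger0_norm// modulus_ge0.
Qed.

Lemma Lp_norm_y_le f (M : R) :
  (Lp_norm +oo%E f <= M%:E)%E <-> {ae mu, forall w, modulus (f (cis w)) <= M}.
Proof.
rewrite Lp_norm_yE; split => [/ess_supP h|h].
  by apply: (ae_imp h) => w; rewrite lee_fin.
by apply/ess_supP; apply: (ae_imp h) => w; rewrite lee_fin.
Qed.

Lemma Lp_norm_ge0 p f : (0 <= Lp_norm p f)%E.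
Proof. exact: Lnorm_ge0. Qed.

Lemma Lp_y_ae_bounded f : Lp +oo%E f <-> ae_bounded f.
Proof.
split=> [[mf fy]|[mf [M /Lp_norm_y_le fM]]]; last first.
  by split => //; apply: le_lt_trans fM _; rewrite ltry.
split => //; exists (fine (Lp_norm +oo%E f)); apply/Lp_norm_y_le.
by rewrite fineK// ge0_fin_numE// Lp_norm_ge0.
Qed.

(** * Norm bounds and the extremal problem for a fixed symbol *)

Section fixed_symbol.
Variable g : circle R -> R[i].
Hypothesis gb : ae_bounded g.

Lemma hankelP y : Hardy 2%:E y -> Hardy 2%:E (hankel g y) /\
  forall k, Hardy 2%:E k -> inner (fun z => g z * reversion y z) k = inner (hankel g y) k.
Proof.
move=> /Hardy2P[yi _].
have gyi : sqintegrable (mul_op g (reversion y)).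
  by apply: ae_bounded_mul => //; exact: sqintegrable_reversion.
have [H ort] := orth_projP gyi; split => // k Hk; have [ki _] := (Hardy2P k).1 Hk.
have [hi _] := (Hardy2P _).1 H.
by apply/eqP; rewrite -subr_eq0 -innerB// ort.
Qed.

Lemma Hardy_perp_inftyP f : Hardy_perp_infty f <-> ae_bounded f /\
  forall m : nat, inner f (fun z => sval z ^ (- m%:Z)) = 0.
Proof.
split=> [[/Lp_y_ae_bounded fb f0]|[fb f0]]; split => //.
- by move=> m; rewrite -fourierE f0//; lia.
- exact/Lp_y_ae_bounded.
- by move=> n n0; rewrite fourierE -(f0 `|n|%N); congr (inner f _); apply/funext => z; congr (_ ^
    _); lia.
Qed.

(** Subtracting [f] does not change the Hankel operator: the pairing of [f R y] with an H_2 function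
    [h] is that of [f] with [sharp y * h], hence zero. Pairing the product with the image of [y] and
    Cauchy-Schwarz then give the bound. *)
Lemma sqnorm_hankel_le f y : Hardy_perp_infty f -> Hardy 2%:E y ->
  sqnorm (hankel g y) <= sqnorm (fun z => (g z - f z) * reversion y z).
Proof.
move=> /Hardy_perp_inftyP[fb f0] Hy; have [yi _] := (Hardy2P y).1 Hy.
have [Hh hP] := hankelP Hy; have [hi _] := (Hardy2P _).1 Hh.
have ri := sqintegrable_reversion yi.
have gyi := ae_bounded_mul gb ri; have fyi := ae_bounded_mul fb ri.
set G := fun z => (g z - f z) * reversion y z.
have GE : G = fun z => g z * reversion y z - f z * reversion y z.
  by apply/funext => z; rewrite /G mulrBl.
have Gi : sqintegrable G by rewrite GE; exact: sqintegrableB.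
have E : inner G (hankel g y) = (sqnorm (hankel g y))%:C.
  rewrite GE innerB// hP// -inner_self (_ : inner (fun z => f z * _) _ = 0) ?subr0//.
  rewrite -[RHS](inner_Hardy2_mul fb f0 (Hardy2_sharp Hy) Hh) inner_mulr.
  by rewrite /sharp; congr inner; apply/funext => z; rewrite conjcK.
have := cauchy_schwarz Gi hi; rewrite E modulusR real_normK ?num_real//.
have := sqnorm_ge0 (hankel g y); rewrite le_eqVlt => /predU1P[<- _|h0]; first exact: sqnorm_ge0.
by rewrite expr2 ler_pM2r.
Qed.

Lemma sqnorm_symbol_le f y (M : R) : ae_bounded f -> Hardy 2%:E y ->
  {ae mu, forall w, modulus (g (cis w) - f (cis w)) <= M} ->
  sqnorm (fun z => (g z - f z) * reversion y z) <= M ^+ 2 * sqnorm y.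
Proof.
move=> fb /Hardy2P[yi _] gfM; rewrite -[sqnorm y]sqnorm_reversion//.
have mgf : circle_measurable (fun z => g z - f z) by apply: circle_measurableB; [case: gb|case:
    fb].
by have [] := sqintegrable_bounded_mul mgf gfM (sqintegrable_reversion yi).
Qed.

Lemma le_sqrt_sqnorm h (M : R) : 0 <= M -> sqintegrable h ->
  (Lp_norm 2%:E h <= M%:E)%E = (sqnorm h <= M ^+ 2).
Proof.
move=> M0 hi; rewrite Lp_norm2// lee_fin -[in LHS](ger0_norm M0) -sqrtr_sqr.
by rewrite ler_sqrt// sqr_ge0.
Qed.

Lemma H2_opnorm_ge0 : (0 <= H2_opnorm (hankel g))%E.
Proof.
apply: (@le_trans _ _ (Lp_norm 2%:E (hankel g (fun=> 0)))); first exact: Lp_norm_ge0.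
apply: ereal_sup_ubound; exists (fun=> 0) => //; split; first exact: Hardy2_0.
rewrite le_sqrt_sqnorm//; last exact: sqintegrable_cst.
rewrite /sqnorm Rintegral_cst// (_ : modulus 0 = 0); last by apply/eqP; rewrite modulus_eq0.
by rewrite expr0n mul0r expr1n.
Qed.

Lemma H2_opnorm_le f : Hardy_perp_infty f ->
  (H2_opnorm (hankel g) <= Lp_norm +oo%E (fun z => (g z - f z)%R))%E.
Proof.
move=> Hf; have [fb _] := (Hardy_perp_inftyP f).1 Hf.
have [->|ny] := eqVneq (Lp_norm +oo%E (fun z => (g z - f z)%R)) +oo%E; first by rewrite leey.
have fin : Lp_norm +oo%E (fun z => (g z - f z)%R) \is a fin_num.
  by rewrite ge0_fin_numE ?Lp_norm_ge0// ltey.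
set M := fine (Lp_norm +oo%E (fun z => (g z - f z)%R)).
have M0 : 0 <= M by rewrite fine_ge0// Lp_norm_ge0.
rewrite -(fineK fin) -/M.
have gfM : {ae mu, forall w, modulus (g (cis w) - f (cis w)) <= M}.
  by apply/(Lp_norm_y_le (fun z => g z - f z)); rewrite fineK.
apply: ge_ereal_sup => _ [y [Hy y1] <-].
have [yi _] := (Hardy2P y).1 Hy.
have [Hh _] := hankelP Hy; have [hi _] := (Hardy2P _).1 Hh.
rewrite le_sqrt_sqnorm//; apply: le_trans (sqnorm_hankel_le Hf Hy) _.
apply: le_trans (sqnorm_symbol_le fb Hy gfM) _.
move: y1; rewrite le_sqrt_sqnorm// expr1n => y1.
by rewrite ler_piMr// sqr_ge0.
Qed.

Lemma H2_opnorm_fin_num : H2_opnorm (hankel g) \is a fin_num.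
Proof.
rewrite ge0_fin_numE ?H2_opnorm_ge0//.
have z0 : Hardy_perp_infty (fun _ : circle R => 0 : R[i]).
  apply/Hardy_perp_inftyP; split; last by move=> m; rewrite inner0l//; exact: sqintegrable_char.
  split; first exact: circle_measurable_cst.
  by exists 0; apply: nearW => w; rewrite le_eqVlt modulus_eq0 eqxx.
apply: le_lt_trans (H2_opnorm_le z0) _.
have /Lp_y_ae_bounded[_] : ae_bounded (fun z => g z - 0) by under eq_fun do rewrite subr0.
by [].
Qed.

Local Notation r := (fine (H2_opnorm (hankel g))).

Lemma opnorm_ge0 : 0 <= r. Proof. by rewrite fine_ge0// H2_opnorm_ge0. Qed.

Lemma sqnorm_hankel_unit y : Hardy 2%:E y -> sqnorm y <= 1 -> sqnorm (hankel g y) <= r ^+ 2.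
Proof.
move=> Hy y1; have [yi _] := (Hardy2P y).1 Hy.
have [Hh _] := hankelP Hy; have [hi _] := (Hardy2P _).1 Hh.
rewrite -le_sqrt_sqnorm ?opnorm_ge0// fineK ?H2_opnorm_fin_num//.
apply: ereal_sup_ubound; exists y => //; split => //.
by rewrite le_sqrt_sqnorm// expr1n.
Qed.

Lemma inner_symbol_le k : Hardy 2%:E k -> modulus (inner g k) <= r * L1norm k.
Proof.
move=> Hk; have K0 : 0 <= L1norm k by apply: Rintegral_ge0 => w _; exact: modulus_ge0.
have [ki _] := (Hardy2P k).1 Hk.
rewrite -(@ler_pXn2r _ 2)// ?nnegrE ?modulus_ge0 ?mulr_ge0 ?opnorm_ge0//.
rewrite exprMn; set c := modulus _ ^+ 2.
have bound e : 0 < e -> c <= r ^+ 2 * ((L1norm k + e) * L1norm k).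
  move=> e0; have [q [x [Hq Hx q1 xle kE]]] := Hardy2_factor e0 Hk.
  have [qi _] := (Hardy2P q).1 Hq; have [xi _] := (Hardy2P x).1 Hx.
  have Hs := Hardy2_sharp Hq.
  have [Hh hP] := hankelP Hs; have [hi _] := (Hardy2P _).1 Hh.
  (* Since [reversion (sharp q)] is [conj(q)], the factor [q] of [k] passes to the side of [g],
     where [hankelP] recognizes the operator. *)
  rewrite /c (_ : inner g k = inner (hankel g (sharp q)) x).
    apply: le_trans (cauchy_schwarz hi xi) _.
    apply: ler_pM => //; try exact: sqnorm_ge0.
    by apply: sqnorm_hankel_unit => //; rewrite sqnorm_sharp// q1.
  rewrite -hP// reversion_sharp -inner_mulr.
  apply: inner_aer => //; [exact: ki.1| |by case: gb].
  by apply: circle_measurableM; [exact: qi.1|exact: xi.1].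
apply/ler_addgt0Pr => e e0.
have d0 : 0 < r ^+ 2 * L1norm k + 1 by rewrite ltr_wpDl// mulr_ge0 ?sqr_ge0.
apply: le_trans (bound _ (divr_gt0 e0 d0)) _.
set t := e / _; have -> : r ^+ 2 * ((L1norm k + t) * L1norm k) =
  r ^+ 2 * L1norm k ^+ 2 + r ^+ 2 * L1norm k * t by ring.
by rewrite lerD2l /t mulrA ler_pdivrMr// mulrC ler_pM2l// lerDl.
Qed.

(** The projection of [a] is carried as a second component, characterized by orthogonality.
    [orth_proj] selects an arbitrary representative, so it would not commute with midpoints or
    limits as functions. *)
Definition ball_pairs : set ((circle R -> R[i]) * (circle R -> R[i])) :=
  [set ak | [/\ circle_measurable ak.1,
    {ae mu, forall w, modulus (g (cis w) - ak.1 (cis w)) <= r}, Hardy 2%:E ak.2 & forall h, Hardy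
        2%:E h -> inner (fun z => ak.1 z - ak.2 z) h = 0]].

Lemma ball_pairs_bounded : exists2 B : R, 0 <= B &
  forall ak, ball_pairs ak -> {ae mu, forall w, modulus (ak.1 (cis w)) <= B}.
Proof.
have [_ [M gM]] := gb; exists (r + `|M|); first by rewrite addr_ge0 ?opnorm_ge0.
move=> [a k] [/= _ ga _ _]; apply: (ae_imp2 gM ga) => w h1 h2.
rewrite -[a _](subrK (g (cis w))) (le_trans (modulusD _ _))// modulusB lerD//.
by rewrite (le_trans h1)// ler_norm.
Qed.

Lemma ball_pairs_ae_bounded ak : ball_pairs ak -> ae_bounded ak.1.
Proof.
by move=> Hak; have [B _ /(_ _ Hak) aB] := ball_pairs_bounded; split; [case: Hak|exists B].
Qed.

Lemma ball_pairs_proj (a : circle R -> R[i]) : circle_measurable a ->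
  {ae mu, forall w, modulus (g (cis w) - a (cis w)) <= r} -> exists k, ball_pairs (a, k).
Proof.
move=> ma ga; have ai : sqintegrable a.
  have gai : sqintegrable (fun z => g z - a z).
    by apply: (sqintegrable_bounded _ ga); apply: circle_measurableB => //; case: gb.
  have := sqintegrableB (ae_bounded_sq gb) gai.
  by under eq_fun do rewrite opprB addrC subrK.
by have [k [Hk kP]] := Hardy2_projection ai; exists k.
Qed.

Lemma ball_pairs_convex (t : R) (a k b l : circle R -> R[i]) : 0 <= t <= 1 -> ball_pairs (a, k)
    -> ball_pairs (b, l) ->
  ball_pairs (fun z => (1 - t)%:C * a z + t%:C * b z, fun z => (1 - t)%:C * k z + t%:C * l z).
Proof.
move=> /andP[t0 t1] Ha Hb.
have ai := ae_bounded_sq (ball_pairs_ae_bounded Ha).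
have bi := ae_bounded_sq (ball_pairs_ae_bounded Hb).
have [/= ma ga Hk ak] := Ha; have [/= mb gb' Hl bl] := Hb.
have [ki _] := (Hardy2P k).1 Hk; have [li _] := (Hardy2P l).1 Hl.
have t1' : 0 <= 1 - t by rewrite subr_ge0.
split => /=.
- by apply: circle_measurableD; apply: circle_measurableM => //; exact: circle_measurable_cst.
- apply: (ae_imp2 ga gb') => w h1 h2.
  have -> : g (cis w) - ((1 - t)%:C * a (cis w) + t%:C * b (cis w)) =
     (1 - t)%:C * (g (cis w) - a (cis w)) + t%:C * (g (cis w) - b (cis w)).
    by rewrite rmorphB rmorph1; ring.
  apply: le_trans (modulusD _ _) _; rewrite !modulusM !modulusR !ger0_norm//.
  have := ler_wpM2l t1' h1; have := ler_wpM2l t0 h2; lra.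
- by apply: Hardy2D; exact: Hardy2Z.
- move=> h Hh; have [hi _] := (Hardy2P h).1 Hh.
  have -> : (fun z => (1 - t)%:C * a z + t%:C * b z - ((1 - t)%:C * k z + t%:C * l z)) =
      (fun z => (1 - t)%:C * (a z - k z) + t%:C * (b z - l z)).
    by apply/funext => z; ring.
  have aki := sqintegrableB ai ki; have bli := sqintegrableB bi li.
  rewrite innerD ?innerZ ?ak ?bl ?mulr0 ?addr0//; exact: sqintegrableZ.
Qed.

Lemma half_sum (k l : circle R -> R[i]) :
  (fun z => (1 - 2^-1)%:C * k z + (2^-1)%:C * l z) = (fun z => 2^-1 * (k z + l z)).
Proof.
apply/funext => z; rewrite mulrDr (_ : 1 - 2^-1 = 2^-1 :> R); last by field.
by rewrite (_ : (2^-1 : R)%:C = 2^-1 :> R[i]) // fmorphV rmorph_nat.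
Qed.

(** Expand [t] times the squared norm of [f - t^-1 h], which is nonnegative. The weight on [f] can
    be taken arbitrarily close to 1, so that bounds on norms pass to closures without losing a
    constant. *)
Lemma sqnorm_young (t : R) (f h : circle R -> R[i]) : 0 < t -> sqintegrable f -> sqintegrable h ->
  sqnorm (fun z => f z + h z) <= (1 + t) * sqnorm f + (1 + t^-1) * sqnorm h.
Proof.
move=> t0 fi hi.
have E b : sqnorm (fun z => f z + b%:C * h z) =
    sqnorm f + 2 * b * complex.Re (inner f h) + b ^+ 2 * sqnorm h.
  rewrite sqnormD// conjc_real modulusR real_normK ?num_real// RecM /=.
  by rewrite mul0r subr0 mulrA.
have := sqnorm_ge0 (fun z => f z + (- t^-1)%:C * h z); rewrite E => h1.
have -> : (fun z => f z + h z) = (fun z => f z + 1%:C * h z) by apply/funext => z; rewrite mul1r.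
rewrite E expr1n !mul1r mulr1.
have : 0 <= t * (sqnorm f + 2 * - t^-1 * complex.Re (inner f h) + (- t^-1) ^+ 2 * sqnorm h).
  by rewrite mulr_ge0// ltW.
have -> : t * (sqnorm f + 2 * - t^-1 * complex.Re (inner f h) + (- t^-1) ^+ 2 * sqnorm h) =
  t * sqnorm f - 2 * complex.Re (inner f h) + t^-1 * sqnorm h by field; rewrite gt_eqF.
rewrite !mulrDl !mul1r; lra.
Qed.

Lemma sqnorm_L2closure (S : set (circle R -> R[i])) h (B : R) :
  (forall s, S s -> sqintegrable s /\ sqnorm s <= B) -> L2closure S h -> sqnorm h <= B.
Proof.
move=> SB [hi hS]; have step t : 0 < t -> sqnorm h <= (1 + t) * B.
  move=> t0; apply/ler_addgt0Pr => e e0.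
  have d0 : 0 < 1 + t^-1 by rewrite addr_gt0// invr_gt0.
  have [s [/SB[si sB] lt]] := hS _ (divr_gt0 e0 d0).
  have := sqnorm_young t0 si (sqintegrableB hi si).
  rewrite (_ : (fun z => s z + (h z - s z)) = h); last by apply/funext => z; rewrite addrC subrK.
  move=> /le_trans; apply; apply: lerD; first by rewrite ler_wpM2l// addr_ge0// ltW.
  by rewrite sqnormBC mulrC -ler_pdivlMr// ltW.
have [s [/SB[_ /(le_trans (sqnorm_ge0 _)) B0] _]] := hS 1 ltr01.
apply/ler_addgt0Pr => e e0; have d0 : 0 < B + 1 by rewrite ltr_wpDl.
apply: le_trans (step _ (divr_gt0 e0 d0)) _.
rewrite mulrDl mul1r lerD2l mulrAC ler_pdivrMr// ler_pM2l// lerDl.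
exact: ler01.
Qed.

(** Here [q1] is the squared norm of [k] and [q2] that of [a], bounded by [B^2] because the circle
    has mass 1. The two defects make both components Cauchy, and the constraints are closed in
    L_2. *)
Lemma ball_pairs_min : exists a k : circle R -> R[i], ball_pairs (a, k) /\
  forall b l, ball_pairs (b, l) -> sqnorm k <= sqnorm l.
Proof.
have [B B0 aB] := ball_pairs_bounded.
pose mid (p q : (circle R -> R[i]) * (circle R -> R[i])) : (circle R -> R[i]) * (circle R ->
    R[i]) :=
  (fun z => (1 - 2^-1)%:C * p.1 z + (2^-1)%:C * q.1 z,
   fun z => (1 - 2^-1)%:C * p.2 z + (2^-1)%:C * q.2 z).
have i1 p : ball_pairs p -> sqintegrable p.1 by move=> /ball_pairs_ae_bounded /ae_bounded_sq.
have i2 p : ball_pairs p -> sqintegrable p.2 by move=> [_ _ /Hardy2P[]].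
have par1 p q : ball_pairs p -> ball_pairs q -> 2 * sqnorm p.1 + 2 * sqnorm q.1 - 4 * sqnorm (mid
    p q).1 =
    sqnorm (fun z => p.1 z - q.1 z).
  by move=> Hp Hq; rewrite /mid /= half_sum sqnorm_parallelogram//; exact: i1.
have par2 p q : ball_pairs p -> ball_pairs q -> 2 * sqnorm p.2 + 2 * sqnorm q.2 - 4 * sqnorm (mid
    p q).2 =
    sqnorm (fun z => p.2 z - q.2 z).
  by move=> Hp Hq; rewrite /mid /= half_sum sqnorm_parallelogram//; exact: i2.
have [] := @convex_min_seq R _ ball_pairs (fun p => sqnorm p.2) (fun p => sqnorm p.1) mid (B ^+
    2).
- have [||k Hk] := @ball_pairs_proj g; last by exists (g, k).
    by case: gb.
  apply: nearW => w; rewrite subrr (_ : modulus 0 = 0) ?opnorm_ge0//.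
  by apply/eqP; rewrite modulus_eq0.
- move=> [a k] [b l] Ha Hb; apply: ball_pairs_convex => //.
  by apply/andP; split; lra.
- by move=> p _; exact: sqnorm_ge0.
- move=> p Hp; rewrite sqnorm_ge0 /=.
  have [_] := sqintegrable_bounded_mul (i1 _ Hp).1 (aB _ Hp) (sqintegrable_cst 1).
  have -> : sqnorm (fun _ : circle R => 1 : R[i]) = 1.
    rewrite /sqnorm Rintegral_cst// arc_measureT mulr1 (_ : modulus 1 = 1) ?expr1n//.
    by rewrite modulusE Normc.normc1.
  by rewrite mulr1; under [fun z => _]eq_fun do rewrite mulr1.
- by move=> p q Hp Hq /=; rewrite par2// sqnorm_ge0.
- by move=> p q Hp Hq /=; rewrite par1// sqnorm_ge0.
move=> d [u [dmin Ku uC]].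
have [e e0|a [ai ua]] := @sqintegrable_complete R (fun n => (u n).1) (fun n => i1 _ (Ku n)).
  have [N HN] := uC _ e0; exists N => n m Nn Nm.
  by have [_ _ +] := HN n m Nn Nm; rewrite par1// => /ltW.
have [e e0|k [ki uk]] := @sqintegrable_complete R (fun n => (u n).2) (fun n => i2 _ (Ku n)).
  have [N HN] := uC _ e0; exists N => n m Nn Nm.
  by have [_ + _] := HN n m Nn Nm; rewrite par2// => /ltW.
have Hk : Hardy 2%:E k.
  apply: Hardy2_closed; apply: (L2closure_seq ki _ uk) => n.
  by have [] := Ku n.
exists a, k; split; last first.
  (* It remains to bound the squared norm of [k] by [d + e]: the tail of the sequence satisfies
     this, and [k] lies in its closure. *)
  move=> b l /dmin; apply: le_trans; apply/ler_addgt0Pr => e e0 /=.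
  have [N HN] := uC _ e0.
  pose S := [set s | exists n, (N <= n)%N /\ s = (u n).2].
  apply: (@sqnorm_L2closure S) => [_ [n [Nn ->]]|].
    by split; [exact: i2|have [/ltW] := HN n n Nn Nn].
  apply: (@L2closure_seq _ S (fun n => (u (N + n)%N).2)) => // [n|e' /uk[N' HN']].
    by exists (N + n)%N; split => //; exact: leq_addr.
  by exists N' => n Nn; apply: HN'; exact: leq_trans (leq_addl _ _).
split => //=; first exact: ai.1.
- have gi := ae_bounded_sq gb.
  (* The excess of [|g - a|] over the radius is at most [|u n - a|] almost everywhere, for every
     [n]; its L_2 norm is therefore zero. *)
  pose pos z : R := Num.max (modulus (g z - a z) - r) 0.
  have mpos : circle_measurable (fun z => (pos z)%:C).
    apply: circle_measurable_real; apply: measurable_maxr => //.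
    apply: measurable_funB => //; apply: (measurable_modulus (f := fun z => g z - a z)).
    exact: circle_measurableB gi.1 ai.1.
  have pos_ge0 z : 0 <= pos z by rewrite le_max lexx orbT.
  have posi : sqintegrable (fun z => (pos z)%:C).
    apply: (sqintegrable_le mpos (sqintegrableB gi ai)) => z.
    by rewrite modulusR ger0_norm// ge_max modulus_ge0 andbT lerBlDr lerDl opnorm_ge0.
  have pos0 : sqnorm (fun z => (pos z)%:C) = 0.
    apply/eqP; rewrite eq_le sqnorm_ge0 andbT; apply/ler_addgt0Pl => e /ua[N /(_ N (leqnn N))].
    rewrite addr0; apply: le_trans.
    rewrite -lee_fin -!sqnormE//; last exact: sqintegrableB (i1 _ (Ku N)) ai.
    apply: ae_ge0_le_integral => //.
    + by move=> w _; rewrite lee_fin sqr_ge0.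
    + exact: (measurable_sqmodulus mpos).
    + by move=> w _; rewrite lee_fin sqr_ge0.
    + exact: (measurable_sqmodulus (circle_measurableB (i1 _ (Ku N)).1 ai.1)).
    + have [_ gu _ _] := Ku N; apply: (ae_imp gu) => w h _; rewrite lee_fin.
      rewrite lerXn2r ?nnegrE ?modulus_ge0// modulusR ger0_norm// ge_max modulus_ge0 andbT.
      rewrite lerBlDr -[g _](subrK ((u N).1 (cis w))) -addrA addrC.
      by apply: le_trans (modulusD _ _) _; rewrite addrC lerD.
  apply: (ae_imp (sqnorm_eq0 posi pos0)) => w /(congr1 (@complex.Re R)) /= p0.
  by rewrite -subr_le0 -p0 le_max lexx.
- move=> h Hh; have [hi _] := (Hardy2P h).1 Hh.
  pose S := [set s | exists n, s = fun z => (u n).1 z - (u n).2 z].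
  apply: (@inner_L2closure R S) => // [_ [n ->]|].
    split; first exact: sqintegrableB (i1 _ (Ku n)) (i2 _ (Ku n)).
    by have [_ _ _] := Ku n; apply.
  split; first exact: sqintegrableB.
  move=> e e0; have e8 : 0 < e / 8%:R by rewrite divr_gt0.
  have [N1 H1] := ua _ e8; have [N2 H2] := uk _ e8.
  pose n := maxn N1 N2; exists (fun z => (u n).1 z - (u n).2 z); split; first by exists n.
  have -> : (fun z => (u n).1 z - (u n).2 z - (a z - k z)) =
      (fun z => ((u n).1 z - a z) + - ((u n).2 z - k z)) by apply/funext => z; ring.
  have d1 := sqintegrableB (i1 _ (Ku n)) ai; have d2 := sqintegrableB (i2 _ (Ku n)) ki.
  apply: le_lt_trans (sqnorm_triangle d1 (sqintegrableN d2)) _.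
  rewrite sqnormN; have := H1 n (leq_maxl _ _); have := H2 n (leq_maxr _ _); lra.
Qed.

Lemma Nehari_extremal : exists f, Hardy_perp_infty f /\
  {ae mu, forall w, modulus (g (cis w) - f (cis w)) <= r}.
Proof.
have [a [k [Hak kmin]]] := ball_pairs_min.
have ai := ae_bounded_sq (ball_pairs_ae_bounded Hak).
have [ma ga Hk ak] : [/\ circle_measurable a,
    {ae mu, forall w, modulus (g (cis w) - a (cis w)) <= r}, Hardy 2%:E k &
    forall h, Hardy 2%:E h -> inner (fun z => a z - k z) h = 0] := Hak.
have [ki _] := (Hardy2P k).1 Hk.
have gi := ae_bounded_sq gb.
(* First-order condition along the segment from [(a, k)] to [(b, l)]: the real part of
   [inner k (l - k)] is nonnegative, and [b] and [l] have the same inner product with [k]. *)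
have variation b l : ball_pairs (b, l) -> sqnorm k <= complex.Re (inner b k).
  move=> Hbl; have bi := ae_bounded_sq (ball_pairs_ae_bounded Hbl).
  have [Hl bl] : Hardy 2%:E l /\ forall h, Hardy 2%:E h -> inner (fun z => b z - l z) h = 0.
    by case: Hbl.
  have [li _] := (Hardy2P l).1 Hl.
  have lki := sqintegrableB li ki.
  have key t : 0 < t <= 1 -> 0 <= 2 * complex.Re (inner k (fun z => l z - k z)) +
      t * sqnorm (fun z => l z - k z).
    move=> /andP[t0 t1]; have := kmin _ _ (ball_pairs_convex _ Hak Hbl) => /(_ t).
    rewrite (ltW t0) t1 => /(_ isT).
    have -> : (fun z => (1 - t)%:C * k z + t%:C * l z) = (fun z => k z + t%:C * (l z - k z)).
      by apply/funext => z; rewrite rmorphB rmorph1; ring.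
    rewrite sqnormD// conjc_real modulusR real_normK ?num_real// RecM /= mul0r subr0.
    rewrite -addrA lerDl => h; rewrite -(pmulr_rge0 _ t0); apply: le_trans h _.
    rewrite le_eqVlt; apply/orP; left; apply/eqP; ring.
  have ge0 : 0 <= complex.Re (inner k (fun z => l z - k z)).
    rewrite -(pmulr_rge0 _ (ltr0Sn R 1)); apply/ler_addgt0Pr => e e0.
    (* With this denominator [t] stays at most 1 and [t] times the squared norm of [l - k] stays at
       most [e]. *)
    have d0 : 0 < sqnorm (fun z => l z - k z) + e + 1.
      by rewrite ltr_wpDl// addr_ge0 ?sqnorm_ge0// ltW.
    have t01 : 0 < e / (sqnorm (fun z => l z - k z) + e + 1) <= 1.
      rewrite divr_gt0//= ler_pdivrMr// mul1r -addrA [e + _]addrC addrA lerDr addr_ge0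
          ?sqnorm_ge0//.
    apply: le_trans (key _ t01) _; rewrite lerD2l mulrAC ler_pdivrMr// ler_pM2l//.
    by rewrite -addrA lerDl addr_ge0// ltW.
  have -> : inner b k = inner l k.
    by apply/eqP; rewrite -subr_eq0 -innerB// bl.
  move: ge0; rewrite inner_conj// Rec_conj innerB// inner_self RecD RecN /=.
  by rewrite subr_ge0.
(* The phase of [k]; where [k = 0] the convention [0^-1 = 0] gives the value 0, so the modulus never
   exceeds 1 and [g - r s] is admissible. *)
pose s z := k z * ((modulus (k z))^-1)%:C.
have ms : circle_measurable s.
  apply: circle_measurableM; first exact: ki.1.
  apply: circle_measurable_real; apply: measurable_invr_ge0 => [w|]; first exact: modulus_ge0.
  exact: measurable_modulus ki.1.
have s1 z : modulus (s z) <= 1.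
  rewrite modulusM modulusR ger0_norm ?invr_ge0 ?modulus_ge0//.
  have [->|k0] := eqVneq (modulus (k z)) 0; first by rewrite mul0r.
  by rewrite divff.
have si : sqintegrable s by apply: (sqintegrable_bounded ms (M := 1)); apply: nearW => w; exact:
    s1.
pose b z := g z + (- r)%:C * s z.
have [||l Hbl] := @ball_pairs_proj b.
- apply: circle_measurableD; first exact: gi.1.
  by apply: circle_measurableM => //; exact: circle_measurable_cst.
- apply: nearW => w; rewrite /b opprD addNKr modulusN modulusM modulusR normrN ger0_norm
    ?opnorm_ge0//.
  by rewrite ler_piMr ?opnorm_ge0.
have := variation _ _ Hbl.
have -> : inner b k = inner g k + (- r)%:C * (L1norm k)%:C.
  rewrite innerD//; last exact: sqintegrableZ.
  rewrite innerZ//; congr (_ + _ * _).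
  rewrite innerE /L1norm -(circle_integral_real (fun z => modulus (k z))).
  congr circle_integral; apply/funext => z.
  rewrite /s mulrAC mul_conj -rmorphM; congr (_%:C).
  have [->|k0] := eqVneq (modulus (k z)) 0; first by rewrite invr0 mulr0.
  by rewrite expr2 mulfK.
rewrite -rmorphM RecD /= => le.
have k0 : sqnorm k = 0.
  apply/eqP; rewrite eq_le sqnorm_ge0 andbT; apply: le_trans le _.
  rewrite mulNr subr_le0; apply: le_trans (inner_symbol_le Hk).
  by apply: le_trans (normr_Re _); exact: ler_norm.
have kae := sqnorm_eq0 ki k0.
exists a; split => //; apply/Hardy_perp_inftyP; split; first exact: (ball_pairs_ae_bounded Hak).
(* As [k] is null, the orthogonality of [a - k] to H_2 becomes that of [a]; it is tested on the
   characters of H_2. *)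
move=> m; have Hm : Hardy 2%:E (fun z : circle R => sval z ^ (- m%:Z)).
  apply/Hardy2P; split; first exact: sqintegrable_char.
  by move=> n n1; rewrite fourierE inner_char; case: eqP n1 => // <-; lia.
have := ak _ Hm; rewrite innerB//; last exact: sqintegrable_char.
rewrite (@inner_ae _ k (fun=> 0)).
- by rewrite inner0l ?subr0//; exact: sqintegrable_char.
- exact: ki.1.
- exact: circle_measurable_cst.
- exact: circle_measurable_char.
- exact: kae.
Qed.

End fixed_symbol.
End hankel.

(** * Constant modulus of the error *)

Section extremal_modulus.
Variable R : realType.
Local Notation mu := (arc_measure R).

(** The squared norm of [(g - f) R y] lies between that of [hankel g y] and [c^2] times that of [y].
    These coincide, so the pointwise inequality behind the upper bound is an equality almost
    everywhere. *)
Lemma extremal_modulus_constant (g f y : circle R -> R[i]) (c : R) : 0 <= c ->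
  ae_bounded g -> Hardy_perp_infty f ->
  {ae mu, forall w, modulus (g (cis w) - f (cis w)) <= c} ->
  Hardy 2%:E y -> ~ ae_zero y -> sqnorm (hankel g y) = c ^+ 2 * sqnorm y ->
  {ae mu, forall w, modulus (g (cis w) - f (cis w)) = c}.
Proof.
move=> c0 gb Hf gfc Hy ynz hE; have [fb _] := (Hardy_perp_inftyP f).1 Hf.
have [yi _] := (Hardy2P y).1 Hy.
have ri := sqintegrable_reversion yi.
have mgf : circle_measurable (fun z => g z - f z).
  by apply: circle_measurableB; [case: gb|case: fb].
pose G z := (g z - f z) * reversion y z.
have [Gi _] := sqintegrable_bounded_mul mgf gfc ri.
have GE : sqnorm G = c ^+ 2 * sqnorm (reversion y).
  rewrite sqnorm_reversion//; apply/eqP; rewrite eq_le (sqnorm_symbol_le gb fb Hy gfc) -hE.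
  exact: sqnorm_hankel_le.
have syi : sqintegrable (sharp y) by exact: sqintegrable_conj.
(* Reversion leaves H_2, but its conjugate [sharp y] is in H_2 and has the same zeros. *)
have rev_neq0 : {ae mu, forall w, reversion y (cis w) != 0}.
  have snz : ~ ae_zero (sharp y).
    move=> s0; apply: ynz; apply: sqnorm_eq0 => //; rewrite -sqnorm_sharp//.
    rewrite (@sqnorm_ae _ _ (fun=> 0)); first last.
    - by apply: (ae_imp s0) => w ->.
    - exact: circle_measurable_cst.
    - exact: syi.1.
    rewrite /sqnorm Rintegral_cst// (_ : modulus 0 = 0) ?expr0n ?mul0r//.
    by apply/eqP; rewrite modulus_eq0.
  apply: (ae_imp (Hardy2_ae_neq0 (Hardy2_sharp Hy) snz)) => w.
  by rewrite /sharp conjc_eq0.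
(* [psi] equals [(c^2 - |g - f|^2) |R y|^2]: almost everywhere nonnegative with integral zero, hence
   null, and the second factor can be cancelled. *)
pose psi w : R := c ^+ 2 * modulus (reversion y (cis w)) ^+ 2 - modulus (G (cis w)) ^+ 2.
have i1 : mu.-integrable setT (EFin \o (fun w => c ^+ 2 * modulus (reversion y (cis w)) ^+ 2)).
  exact: (integrableZl measurableT (c ^+ 2) ri.2).
have psii : mu.-integrable setT (EFin \o psi) by exact: (integrableB measurableT i1 Gi.2).
have psi0 : (\int[mu]_w (psi w)%:E = 0)%E.
  have : Rintegral mu setT psi = 0.
    rewrite RintegralB//; last exact: Gi.2.
    rewrite RintegralZl//; last exact: ri.2.
    by rewrite -[X in _ - X]/(sqnorm G) GE subrr.
  by move=> int0; rewrite -[LHS](fineK (integrable_fin_num measurableT psii)); congr EFin.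
have psi_ge0 : {ae mu, forall w, 0 <= psi w}.
  apply: (ae_imp gfc) => w h; rewrite /psi /G modulusM exprMn -mulrBl.
  by rewrite mulr_ge0 ?sqr_ge0// subr_ge0 lerXn2r ?nnegrE ?modulus_ge0.
have mpsi : measurable_fun setT (fun w => (psi w)%:E) by case/integrableP: psii.
have : (\int[mu]_w `|(psi w)%:E| = 0)%E.
  rewrite -[RHS]psi0; apply: ae_eq_integral => //; first exact: measurableT_comp.
  by apply: (ae_imp psi_ge0) => w h _; rewrite gee0_abs.
move/ae_eq_integral_abs => /(_ measurableT mpsi) psiae.
apply: (ae_imp2 psiae rev_neq0) => w /(_ I) [] + rn.
rewrite /psi /G modulusM exprMn -mulrBl => /eqP; rewrite mulf_eq0 sqrf_eq0 modulus_eq0 (negPf rn)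
    orbF.
rewrite subr_eq0 eqrXn2 ?modulus_ge0// => /eqP ->.
by [].
Qed.

End extremal_modulus.

Local Close Scope complex_scope.

Theorem theorem4 (R : realType) (g : circle R -> R[i]) (hg : Lp +oo%E g) :
  dist_Hardy_perp g = H2_opnorm (hankel g) /\
  (exists f_opt : circle R -> R[i], Hardy_perp_infty f_opt /\
     Lp_norm +oo%E (fun z => g z - f_opt z) = dist_Hardy_perp g) /\
  (forall f_opt : circle R -> R[i], Hardy_perp_infty f_opt ->
     Lp_norm +oo%E (fun z => g z - f_opt z) = dist_Hardy_perp g ->
     (exists y : circle R -> R[i], Hardy 2%:E y /\ ~ ae_zero y /\
        Lp_norm 2%:E (hankel g y) =
          (H2_opnorm (hankel g) * Lp_norm 2%:E y)%E) ->
     exists c : R, {ae @lebesgue_measure R, forall w : R,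
       w \in `[- pi, pi[ -> modulus (g (cis w) - f_opt (cis w)) = c}).
Proof.
have gb : ae_bounded g by exact/Lp_y_ae_bounded.
have Nfin := H2_opnorm_fin_num gb.
set r := fine (H2_opnorm (hankel g)).
have r0 : 0 <= r := opnorm_ge0 g.
have [f0 [Hf0 gf0]] := Nehari_extremal gb.
have f0_le : (Lp_norm +oo%E (fun z => (g z - f0 z)%R) <= H2_opnorm (hankel g))%E.
  by rewrite -(fineK Nfin); apply/Lp_norm_y_le.
have distE : dist_Hardy_perp g = H2_opnorm (hankel g).
  apply/eqP; rewrite eq_le; apply/andP; split.
    by apply: le_trans f0_le; apply: ereal_inf_lbound; exists f0.
  by apply: le_ereal_inf_tmp => _ [f Hf <-]; exact: H2_opnorm_le.
split => //; split.
  exists f0; split => //; apply/eqP; rewrite eq_le distE f0_le /=.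
  exact: H2_opnorm_le.
move=> f Hf fE [y [Hy [ynz hy]]]; exists r.
have [yi _] := (Hardy2P y).1 Hy.
have [Hh _] := hankelP gb Hy; have [hi _] := (Hardy2P _).1 Hh.
(* On [[-pi, pi)] the arc measure and Lebesgue measure have the same null sets. *)
apply: ae_arc; apply: (extremal_modulus_constant r0 gb Hf _ Hy ynz).
  by apply/(Lp_norm_y_le (fun z => g z - f z)); rewrite fE distE fineK.
move: hy; rewrite -(fineK Nfin) !Lp_norm2// -/r -EFinM => -[hE].
rewrite -[LHS]sqr_sqrtr ?sqnorm_ge0// hE exprMn sqr_sqrtr// sqnorm_ge0//.
Qed.
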